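(* Let $X$ be a complex topological vector space, let $T$ be a continuous linear operator on $X$ and let $x\in X$. The following are equivalent. (i) $x$ is hypercyclic for $T$. (ii) For every polynomial $P\in\mathbb R[t]$, the set $\{e^{iP(n)}T^n x;\ n\geq 1\}$ is dense in $X$. (iii) For some polynomial $P\in\mathbb R[t]$, the closure of the set $\{e^{iP(n)}T^n x;\ n\geq 1\}$ has nonempty interior in $X$.
   Context: A vector $x\in X$ is called hypercyclic for the continuous linear operator $T:X\to X$ if its orbit $\{T^n x;\ n\geq 0\}$ is dense in $X$. *)

(* Defs.v *)
From HB Require Import structures.
From mathcomp Require Import all_boot all_order all_algebra.
From mathcomp Require Import all_classical all_reals all_analysis.
From mathcomp Require Export complex.

Set Implicit Arguments.
Unset Strict Implicit.
Unset Printing Implicit Defensive.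

Import Order.TTheory GRing.Theory Num.Theory.

Local Open Scope classical_set_scope.
Local Open Scope ring_scope.

(* e ^ (i t) for real t, via Euler's formula: the library has no complex
   exponential. *)
Definition expi (R : realType) (t : R) : R[i] := (cos t +i* sin t)%C.

Section Orbits.
Variables (R : realType) (X : topologicalLmodType R[i]).

Definition hypercyclic (T : X -> X) (x : X) : Prop :=
  dense [set iter n T x | n in [set: nat]].

(* The index starts at 1, whereas the orbit in [hypercyclic] starts at 0. *)
Definition twisted_orbit (P : {poly R}) (T : X -> X) (x : X) : set X :=
  [set expi P.[n%:R] *: iter n T x | n in [set n : nat | (1 <= n)%N]].

End Orbits.

(* Main.v *)
Require Import Defs.
From HB Require Import structures.
From mathcomp Require Import all_boot all_order all_algebra.
From mathcomp Require Import all_classical all_reals all_analysis.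
From mathcomp Require Import complex.
From mathcomp Require Import ring lra.

Set Implicit Arguments.
Unset Strict Implicit.
Unset Printing Implicit Defensive.

Import Order.TTheory GRing.Theory Num.Theory.
Import numFieldNormedType.Exports.

Local Open Scope classical_set_scope.
Local Open Scope ring_scope.

(** A vector whose twisted orbit is somewhere dense has, a fortiori, a somewhere
    dense set of unimodular multiples [expi t *: T^n x].  The proof has three
    stages, all of which exploit that the vectors [p(T) x], [p] a polynomial,
    form a large set with simple topology.

    - From somewhere dense to dense ([somewhere_dense_circled]).  This is the
      Bourdon-Feldman argument.  Nonzero polynomials in [T] have dense range
      ([polyop_dense_range]); if [U] is the interior of the closure of the set of
      unimodular multiples, then the complement of [U] is invariant under [T], and
      a polynomial [p] with [p(1) = 1] cannot send [x] to the boundary of [U].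
      As these polynomials form a convex set, the orbit of [x] under them stays
      in [U], and it is dense.

    - Removing phases.  Let operators [a_i(T)] be indexed by [I], let [u_i] be
      phases that are additive in the limit along a filter [G] on [I], and suppose
      that [a_i(T) x] clusters everywhere along [G].  The set [phases x z] of
      the limit phases of [u_i] as [a_i(T) x] approaches [z] satisfies
      [phases x z + phases z v `<=` phases x v].  Hence [phases x x] is a closed
      subgroup of the line containing [2 pi], and [phases x (p(T) x)] is one of its
      cosets.  Either the subgroup is everything, and every phase is reached, or it
      is generated by [2 pi / m]; in that case [p |-> exp (i m t)], for [t] in
      [phases x (p(T) x)], is a continuous multiplicative map from nonzero
      polynomials to the circle ([phases_dichotomy]).  Winding numbers constrain
      this map:

      - for the family [expi t *: T^n] with phase [t], which passes from
        unimodular multiples to the plain orbit, it has winding number [m] on the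
        circle of constants, although that loop is contractible in the nonzero
        polynomials: a contradiction ([circled_phase0]);

      - for the family [T^n], let [alpha] be the angle swept on the segment from
        the constant [1] to the variable.  Along the [n]-th powers of the points of
        this segment the angle swept is [n alpha]; it is the same along the segment
        from [1] to the [n]-th power of the variable, where it is less than [pi / 2]
        whenever [T^n x] is close to [x].  So [alpha = 0], the map is trivial on
        the powers of the variable and, by density, on all polynomials
        ([orbit_phase0]).

      In each case the phase [0] is reached at every vector.

    - Polynomial phases ([return_filter_poly]).  By induction on the degree of [P]
      there is a filter of return times along which the orbit of [x] still clusters
      everywhere while [P(n + i) - P(i)] tends to [0] modulo [2 pi] for every [i].
      The filter for the difference polynomial [P(n + 1) - P(n)] makes the phase
      [P(n) - P(0)] additive in the limit, so the previous stage allows the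
      condition that this phase is small to be adjoined to the filter.  At [i = 0]
      this gives the density of the twisted orbit. *)

(** * Angles modulo two pi *)

(** Equality of angles modulo [2 pi] is expressed as [cos (a - b) = 1], and
    closeness as [1 - e < cos (a - b)].  Real numbers thus stand for points of the
    circle, and the triangle inequality becomes [cos_near1D]. *)

Section Angles.
Variable R : realType.
Implicit Types a b x : R.

Lemma cos1_sin0 x : cos x = 1 -> sin x = 0.
Proof. by move=> h; apply: cos1sin0; rewrite h normr1. Qed.

Lemma cos1D a b : cos a = 1 -> cos b = 1 -> cos (a + b) = 1.
Proof. by move=> ha hb; rewrite cosD ha hb (cos1_sin0 ha) mul0r subr0 mulr1. Qed.

Lemma cos1_transfer a b : cos (a - b) = 1 -> cos a = cos b.
Proof.
move=> h; rewrite -[in LHS](subrK b a) cosD h (cos1_sin0 h).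
by rewrite mul0r subr0 mul1r.
Qed.

Lemma cos1Mn a n : cos a = 1 -> cos (a *+ n) = 1.
Proof.
by move=> ha; elim: n => [|n IH]; rewrite ?mulr0n ?cos0// mulrS cos1D.
Qed.

(** [1 - cos] is half the squared chord length, so this is the parallelogram
    inequality for chords. *)
Lemma cosD_ge a b : 1 - cos (a + b) <= 2 * (1 - cos a) + 2 * (1 - cos b).
Proof.
have ha := cos2Dsin2 a; have hb := cos2Dsin2 b.
have h1 := sqr_ge0 (cos a + cos b - 2).
have h2 := sqr_ge0 (sin a - sin b).
rewrite cosD; nra.
Qed.

Lemma cos_near1D (e a b : R) :
  1 - e < cos a -> 1 - e < cos b -> 1 - 4 * e < cos (a + b).
Proof. by move=> ha hb; have := cosD_ge a b; lra. Qed.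

Lemma cos2pi_int (k : int) : cos (k%:~R * (pi *+ 2)) = 1 :> R.
Proof.
have H n : cos (n%:R * (pi *+ 2)) = 1 :> R.
  by rewrite mulr_natl cos1Mn// cos2pi.
by case: k => n; rewrite ?NegzE ?mulrNz ?mulNr ?cosN; exact: H.
Qed.

Lemma floor_mod c x : 0 < c -> 0 <= x - (Num.floor (x / c))%:~R * c < c.
Proof.
move=> c0; apply/andP; split; first by rewrite subr_ge0 -ler_pdivlMr// ge_floor.
rewrite ltrBlDl -[X in _ < _ + X]mul1r -mulrDl -ltr_pdivrMr//.
by have := floorD1_gt (x / c); rewrite intrD.
Qed.

Lemma twopi_gt0 : 0 < pi *+ 2 :> R.
Proof. by rewrite pmulrn_lgt0// pi_gt0. Qed.

Lemma cos_eq1_int x : cos x = 1 -> exists k : int, x = k%:~R * (pi *+ 2).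
Proof.
move=> cx; pose k := Num.floor (x / (pi *+ 2)); exists k.
pose r := x - k%:~R * (pi *+ 2).
have cr : cos r = 1 by rewrite cos1D// cosN cos2pi_int.
have /andP[r0 r1] : 0 <= r < pi *+ 2 := floor_mod x twopi_gt0.
suff : r = 0 by move/eqP; rewrite subr_eq0 => /eqP.
have [rp|rp] := leP r pi.
  apply: cos_inj; rewrite ?in_itv/= ?r0 ?rp ?lexx ?pi_ge0// cr cos0//.
have : pi *+ 2 - r = 0.
  apply: cos_inj; rewrite ?in_itv/= ?lexx ?pi_ge0 ?andbT//.
    by rewrite subr_ge0 ltW//= lerBlDl mulr2n lerD2r ltW.
  by rewrite cos0 cos1D ?cos2pi// cosN.
by move=> h; move: r1; rewrite -subr_gt0 h ltxx.
Qed.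

Lemma cos_gt0_bound x : `|x| < pi -> 0 < cos x -> `|x| < pi / 2.
Proof.
move=> xp cx; rewrite ltNge; apply/negP => h.
have : cos `|x| <= cos (pi / 2).
  rewrite leNgt; apply/negP; rewrite ltr_cos ?in_itv/= ?normr_ge0 ?(ltW xp)//.
    by rewrite ltNge h.
  have := @pi_gt0 R; lra.
by rewrite cos_norm cos_pihalf leNgt cx.
Qed.

Lemma cos_eq1_small x : `|x| <= pi -> cos x = 1 -> x = 0.
Proof.
move=> xp cx; apply/eqP; rewrite -normr_eq0; apply/eqP.
by apply: cos_inj; rewrite ?in_itv/= ?normr_ge0 ?lexx ?pi_ge0// cos_norm cx cos0.
Qed.

(** By the intermediate value theorem: a path of angles that stays in [2 pi Z]
    cannot move. *)
Lemma cos1_constant (f : R -> R) :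
  (forall s, 0 <= s <= 1 -> {for s, continuous f}) ->
  (forall s, 0 <= s <= 1 -> cos (f s) = 1) -> f 0 = f 1.
Proof.
move=> fc f1; apply/eqP/negPn/negP => ne.
have cf : {within `[0, 1], continuous f}.
  apply: continuous_in_subspaceT => s; rewrite inE/= in_itv/=; exact: fc.
pose d := f 1 - f 0; have d0 : d != 0 by rewrite subr_eq0 eq_sym.
pose t := Num.min 1 (pi / `|d|); have dp : 0 < `|d| by rewrite normr_gt0.
have t0 : 0 < t by rewrite lt_min ltr01/= divr_gt0// pi_gt0.
have t1 : t <= 1 by rewrite ge_min lexx.
have [|s s01 fs] := @IVT R f 0 1 (f 0 + t * d) ler01 cf.
  rewrite ge_min le_max; have -> : f 1 = f 0 + d by rewrite /d addrC subrK.
  move: (ltW t0) t1; case: (ltrgt0P d) d0 => // d0 _ t0' t1'; nra.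
move: s01; rewrite in_itv/= => s01.
have c : cos (t * d) = 1.
  have -> : t * d = f s - f 0 by rewrite fs addrAC subrr add0r.
  by rewrite cos1D ?f1// ?cosN ?f1// ?lexx ?ler01.
have : t * d = 0.
  apply: cos_eq1_small c; rewrite normrM gtr0_norm// -ler_pdivlMr//.
  by rewrite ge_min lexx orbT.
by move/eqP; rewrite mulf_eq0 (negbTE d0) gt_eqF.
Qed.

(** The representative in [(-pi/2, pi/2)] of an angle with positive cosine. *)
Definition principal x := atan (tan x).

Lemma cos_principal x : 0 < cos x -> cos (principal x) = cos x.
Proof.
move=> cx; rewrite cos_atan -cos2_tan2 ?gt_eqF// sqrtrV ?sqr_ge0// sqrtr_sqr.
by rewrite invrK gtr0_norm.
Qed.

Lemma sin_principal x : 0 < cos x -> sin (principal x) = sin x.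
Proof.
move=> cx; have : tan (principal x) = tan x by rewrite atanK.
rewrite /tan cos_principal// => /(congr1 (fun y => y * cos x)).
by rewrite !divfK// gt_eqF.
Qed.

Lemma principal_cong x : 0 < cos x -> cos (principal x - x) = 1.
Proof. by move=> cx; rewrite cosB cos_principal// sin_principal// -!expr2 cos2Dsin2. Qed.

Lemma principal_bound x : `|principal x| < pi / 2.
Proof. by rewrite ltr_norml atan_gtNpi2 atan_ltpi2. Qed.

End Angles.

(** * Angle-valued functions *)

Section AngularContinuity.
Variable R : realType.

Definition angle_continuous (Z : topologicalType) (w : Z -> R) :=
  forall z0 e, 0 < e -> \forall z \near z0, 1 - e < cos (w z - w z0).

Lemma angle_continuousP (Z : topologicalType) (w : Z -> R) :
  angle_continuous w -> continuous (cos \o w) /\ continuous (sin \o w).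
Proof.
have sq (x e : R) : 0 < e -> x ^+ 2 < e ^+ 2 -> `|x| < e.
  move=> e0; rewrite -(real_normK (num_real x)) => h.
  by rewrite ltNge; apply/negP => /(lerXn2r 2); rewrite ?nnegrE ?normr_ge0 ?(ltW e0)
     => /(_ isT isT); rewrite leNgt h.
move=> wc; split=> z0; apply/cvgrPdist_lt => e e0.
all: have e20 : 0 < e ^+ 2 / 2 by rewrite divr_gt0// exprn_gt0.
all: near=> z; have : 1 - e ^+ 2 / 2 < cos (w z - w z0) by near: z; exact: wc.
all: rewrite cosB => h; apply: sq => //=.
all: have ha := cos2Dsin2 (w z); have hb := cos2Dsin2 (w z0).
- have := sqr_ge0 (sin (w z0) - sin (w z)); nra.
- have := sqr_ge0 (cos (w z0) - cos (w z)); nra.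
Unshelve. all: by end_near. Qed.

Lemma continuous_angle (Z : topologicalType) (w : Z -> R) :
  continuous w -> angle_continuous w.
Proof.
move=> wc z0 e e0.
have : cos (w z - w z0) @[z --> z0] --> cos (w z0 - w z0).
  apply: (@continuous_comp _ _ _ (fun z => w z - w z0) cos).
    by apply: cvgB; [exact: wc|exact: cvg_cst].
  exact: continuous_cos.
move/cvgr_gt; apply; rewrite subrr cos0; lra.
Qed.

(** Compactness of the circle, for functions known only through representatives
    of their angles. *)
Lemma cluster_angle (Z : Type) (F : set_system Z) (v : Z -> R) :
  ProperFilter F -> exists t, forall e B, 0 < e -> F B ->
    exists2 z, B z & 1 - e < cos (v z - t).
Proof.
move=> PF; pose k z := Num.floor (v z / (pi *+ 2)).
pose v' z := v z - (k z)%:~R * (pi *+ 2).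
have v'0 z : v' z \in `[0, pi *+ 2].
  by have /andP[h0 h1] := floor_mod (v z) (twopi_gt0 R); rewrite in_itv/= h0 ltW.
have [|t [_ tc]] := @segment_compact R 0 (pi *+ 2) (v' @ F) _.
  by rewrite /fmap/=; apply: filterS filterT => z _; exact: v'0.
exists t => e B e0 FB.
have [||z [[y By <-]] h] := tc (v' @` B) [set s | 1 - e < cos (s - t)].
- by rewrite /fmap/=; apply: filterS FB => z Bz; exists z.
- exact: (@continuous_angle _ id (fun x => cvg_id)).
exists y => //; rewrite /= in h; apply: lt_le_trans h _; rewrite le_eqVlt.
rewrite (@cos1_transfer _ (v' y - t) (v y - t)) ?eqxx//.
have -> : v' y - t - (v y - t) = - ((k y)%:~R * (pi *+ 2)) by rewrite /v'; ring.
by rewrite cosN cos2pi_int.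
Qed.

(** Lifting of a homotopy along the radii [r |-> (s, r)]: for [N] large, the
    increments of the angle over radial steps of length [1 / N.+1] have positive
    cosine by uniform continuity, so [f s] can be taken to be the sum of their
    principal values.  This formula is visibly continuous in [s] and depends on
    the radius only, which gives the last clause; the third one bounds the
    variation along a radius that stays in a half-plane. *)
Lemma angle_lift (w : R * R -> R) : angle_continuous w -> exists f : R -> R,
  [/\ forall s, 0 <= s <= 1 -> {for s, continuous f},
      forall s, 0 <= s <= 1 -> cos (f s - (w (s, 1) - w (s, 0))) = 1,
      forall s, 0 <= s <= 1 ->
        (forall r, 0 <= r <= 1 -> 0 < cos (w (s, r) - w (s, 0))) ->
        `|f s| < pi / 2 &
      forall s t, (forall r, w (s, r) = w (t, r)) -> f s = f t].
Proof.
move=> wc; have [cc sc] := angle_continuousP wc.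
have [N HN] : exists N : nat, forall s r r', 0 <= s <= 1 -> 0 <= r <= 1 ->
    `|r - r'| <= N.+1%:R^-1 -> 0 < cos (w (s, r') - w (s, r)).
  pose P (n : nat) (z : R * R) := forall r', `|z.2 - r'| <= n.+1%:R^-1 ->
    0 < cos (w (z.1, r') - w z).
  have cK : compact (`[0 : R, 1] `*` `[0 : R, 1]).
    by apply: compact_setX; exact: segment_compact.
  have cov := (@compact_near_coveringP _ _).1 cK nat \oo P _.
  have /cov[n _ /(_ n (leqnn n)) hn] : forall z, (`[0 : R, 1] `*` `[0 : R, 1]) z ->
      \forall z' \near z & i \near \oo, P i z'.
    move=> z _; have e0 : 0 < 4^-1 :> R by rewrite invr_gt0.
    have /nbhs_ballP[d/= d0 dw] := wc z _ e0.
    have d20 : 0 < d / 2 by rewrite divr_gt0.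
    near=> z' n => /=; move=> r' r'n.
    have bz : ball z (d / 2) z' by near: z'; exact: nbhsx_ballx.
    have nd : n.+1%:R^-1 < d / 2.
      near: n; exact: (near_infty_natSinv_lt (PosNum d20)).
    have h1 : 1 - 4^-1 < cos (w z' - w z).
      have d2d : d / 2 <= d by lra.
      by apply: dw; exact: le_ball d2d _ bz.
    have h2 : 1 - 4^-1 < cos (w (z'.1, r') - w z).
      apply: dw; case: bz => b1 b2; split => /=.
        by apply: le_ball b1; lra.
      rewrite (splitr d); apply: ball_triangle b2 _.
      by rewrite -ball_normE/=; apply: le_lt_trans r'n nd.
    have h3 : 1 - 4^-1 < cos (w z - w z') by rewrite -(opprB (w z')) cosN.
    have := cos_near1D h2 h3; rewrite addrA subrK.
    by apply: le_lt_trans; lra.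
  exists n => s r r' s01 r01; apply: (hn (s, r)).
  by split; rewrite /= in_itv.
pose x (j : nat) : R := j%:R / N.+1%:R.
have x01 j : (j <= N.+1)%N -> 0 <= x j <= 1.
  by move=> jN; rewrite divr_ge0//= ler_pdivrMr ?ltr0n// mul1r ler_nat.
have xS s j : 0 <= s <= 1 -> (j < N.+1)%N -> 0 < cos (w (s, x j.+1) - w (s, x j)).
  move=> s01 jN; apply: HN => //; first exact: x01 (ltnW _).
  rewrite distrC /x -mulrBl -natr1 addrAC subrr add0r mul1r ger0_norm//.
pose D j s := w (s, x j.+1) - w (s, x j).
pose g n s := \sum_(j < n) principal (D j s).
have ge s n : 0 <= s <= 1 -> (n <= N.+1)%N ->
    cos (g n s - (w (s, x n) - w (s, x 0))) = 1.
  move=> s01; elim: n => [|n IH] nN.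
    by rewrite /g big_ord0 !subrr cos0.
  rewrite /g big_ord_recr/= -/(g n s).
  have -> : g n s + principal (D n s) - (w (s, x n.+1) - w (s, x 0)) =
    (g n s - (w (s, x n) - w (s, x 0))) + (principal (D n s) - D n s) by rewrite /D; ring.
  by apply: cos1D; [apply: IH; exact: ltnW|apply: principal_cong; exact: xS].
have x0 : x 0 = 0 by rewrite /x mul0r.
have x1 : x N.+1 = 1 by rewrite /x divff ?pnatr_eq0.
exists (g N.+1); split.
- move=> s s01; rewrite /g; apply: cvg_big => [|j _ /=]; first exact: add_continuous.
  apply: (@continuous_comp _ _ _ (fun s => tan (D j s)) atan); last first.
    exact: continuous_atan.
  have cw a : cos (w (t, a)) @[t --> s] --> cos (w (s, a)).
    apply: (@continuous_comp _ _ _ (fun s => (s, a)) (cos \o w)); last exact: cc.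
    exact: (cvg_pair (@cvg_id _ _) (cvg_cst _)).
  have sw a : sin (w (t, a)) @[t --> s] --> sin (w (s, a)).
    apply: (@continuous_comp _ _ _ (fun s => (s, a)) (sin \o w)); last exact: sc.
    exact: (cvg_pair (@cvg_id _ _) (cvg_cst _)).
  have E : (fun s => tan (D j s)) = fun s =>
    (sin (w (s, x j.+1)) * cos (w (s, x j)) - cos (w (s, x j.+1)) * sin (w (s, x j)))
    / (cos (w (s, x j.+1)) * cos (w (s, x j)) + sin (w (s, x j.+1)) * sin (w (s, x j))).
    by apply/funext => t; rewrite /tan /D sinB cosB.
  rewrite E; apply: cvgM; first by apply: cvgB; apply: cvgM.
  apply: cvgV; last by apply: cvgD; apply: cvgM.
  by rewrite -cosB gt_eqF// xS.
- by move=> s s01; have := ge s N.+1 s01 (leqnn _); rewrite x0 x1.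
- move=> s s01 h; suff H n : (n <= N.+1)%N -> `|g n s| < pi / 2 by exact: H.
  have pi0 := @pi_gt0 R.
  elim: n => [_|n IH nN]; first by rewrite /g big_ord0 normr0 divr_gt0.
  apply: cos_gt0_bound.
    rewrite /g big_ord_recr/= -/(g n s) (le_lt_trans (ler_normD _ _))//.
    rewrite (splitr pi) ltrD// ?principal_bound//; apply: IH; exact: ltnW.
  by rewrite (cos1_transfer (ge s n.+1 s01 nN)) x0; apply: h; exact: x01.
- by move=> s t st; apply: eq_bigr => j _; rewrite /D !st.
Unshelve. all: by end_near. Qed.

(** Closed subgroups of the circle, seen upstairs: in a compact group a closed
    subsemigroup is a group, and a proper closed subgroup of the line is cyclic;
    its generator divides [2 pi] because [2 pi] belongs to it. *)
Lemma closed_angle_subgroup (H : set R) :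
  (forall a b, H a -> H b -> H (a + b)) ->
  (forall t, (forall e, 0 < e -> exists2 h, H h & 1 - e < cos (h - t)) -> H t) ->
  H !=set0 ->
  (forall t, H t) \/
  exists2 m, (0 < m)%N & forall t, H t <-> cos (t *+ m) = 1.
Proof.
move=> HD Hc [h0 Hh0].
have HM a n : H a -> H (a *+ n.+1).
  by move=> Ha; elim: n => // n IH; rewrite mulrS; exact: HD.
(* two multiples of a close to the same angle give a multiple close to 0 *)
have HN a : H a -> H (- a).
  move=> Ha; apply: Hc => e e0.
  have e40 : 0 < e / 4 by rewrite divr_gt0.
  have [t tP] := @cluster_angle _ \oo (fun n : nat => a *+ n) _.
  have [n _ hn] := tP _ _ e40 (@filterT _ \oo _).
  have [k nk hk] := tP _ _ e40 (nbhs_infty_gt n.+1).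
  exists (a *+ (k - n.+2).+1); first exact: HM.
  have nk' : (n.+1 < k)%N := nk; have nk2 := ltnW nk'; have nk3 := ltnW nk2.
  rewrite opprK -mulrSr (subnSK nk') (subnSK nk2) (mulrnBr _ nk3).
  have hn' : 1 - e / 4 < cos (t - a *+ n) by rewrite -(opprB (a *+ n)) cosN.
  have := cos_near1D hk hn'; rewrite addrA subrK.
  by rewrite mulrC divfK.
have H0 : H 0 by rewrite -(subrr h0); apply: HD => //; exact: HN.
have Hint c (k : int) : H c -> H (k%:~R * c).
  move=> hc; have Hn n : H (n%:R * c).
    by rewrite mulr_natl; case: n => [|n]; [rewrite mulr0n|exact: HM].
  by case: k => n; [exact: Hn|rewrite NegzE mulrNz mulNr; apply: HN; exact: Hn].
have H2pi : H (pi *+ 2) by apply: Hc => e e0; exists 0 => //; rewrite sub0r cosN cos2pi; lra.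
have p0 := twopi_gt0 R.
pose P := [set t | 0 < t /\ H t].
have P0 : P !=set0 by exists (pi *+ 2).
have Plb : has_lbound P by exists 0 => t [/ltW].
have Pinf : has_inf P by [].
have c0 : 0 <= inf P by apply: lb_le_inf => // t [/ltW].
move: c0; rewrite le_eqVlt => /predU1P[c0|c0].
  left=> t; apply: Hc => e e0.
  have /nbhs_ballP[d/= d0 dP] := @continuous_angle _ id (fun x => cvg_id) t e e0.
  have [c [cp Hcc] cd] := inf_adherent d0 Pinf; rewrite -c0 add0r in cd.
  exists ((Num.floor (t / c))%:~R * c); first exact: Hint.
  apply: dP; rewrite -ball_normE/=; have /andP[f0 f1] := floor_mod t cp.
  by rewrite ger0_norm// (lt_trans f1).
right; set c := inf P in c0.
have lec t : P t -> c <= t by move=> Pt; apply: ge_inf.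
have Hcc : H c.
  have [h Ph hc] := inf_adherent c0 Pinf; rewrite -/c in hc.
  have := lec _ Ph; rewrite le_eqVlt => /predU1P[->|ch]; first by case: Ph.
  have hc0 : 0 < h - c by rewrite subr_gt0.
  have [h' Ph' hc'] := inf_adherent hc0 Pinf; rewrite -/c addrC subrK in hc'.
  have : c <= h - h'.
    apply: lec; split; first by rewrite subr_gt0.
    by apply: HD; [case: Ph|apply: HN; case: Ph'].
  by move=> h1; have := lec _ Ph'; lra.
have HcZ t : H t -> exists k : int, t = k%:~R * c.
  move=> Ht; exists (Num.floor (t / c)).
  have /andP[f0 f1] := floor_mod t c0.
  move: f0; rewrite le_eqVlt => /predU1P[/eqP|f0].
    by rewrite eq_sym subr_eq0 => /eqP.
  have : c <= t - (Num.floor (t / c))%:~R * c.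
    apply: lec; split=> //; apply: HD => //; apply: HN; exact: Hint.
  by rewrite leNgt f1.
have [k kE] := HcZ _ H2pi.
have [m mE] : exists m : nat, k = m%:Z.
  case: k kE => [m|m] kE; first by exists m.
  move: p0; rewrite kE NegzE mulrNz mulNr oppr_gt0 ltNge.
  by rewrite mulr_ge0// ?(ltW c0)// ler0z.
have m0 : (0 < m)%N.
  case: m mE => // mE; move: p0; rewrite kE mE mul0r ltxx//.
exists m => // t; split.
  move=> /HcZ[j ->].
  have -> : j%:~R * c *+ m = j%:~R * (pi *+ 2).
    by rewrite kE mE -mulr_natl mulrCA -pmulrn.
  exact: cos2pi_int.
move=> /cos_eq1_int[j]; rewrite kE mE -pmulrn -mulr_natl mulrCA.
have mR : m%:R != 0 :> R by rewrite pnatr_eq0 -lt0n.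
by move=> /(mulfI mR) ->; exact: Hint.
Qed.

Lemma cosMn_near m (e : R) : 0 < e -> exists2 d, 0 < d &
  forall t, 1 - d < cos t -> 1 - e < cos (t *+ m).
Proof.
elim: m e => [|m IH] e e0.
  by exists 1 => // t _; rewrite mulr0n cos0; lra.
have e40 : 0 < e / 4 by rewrite divr_gt0.
have [d d0 hd] := IH _ e40; exists (Num.min d (e / 4)); first by rewrite lt_min d0.
have m1 : Num.min d (e / 4) <= d by rewrite ge_min lexx.
have m2 : Num.min d (e / 4) <= e / 4 by rewrite ge_min lexx orbT.
move=> t ht; rewrite mulrS.
have h1 : 1 - e / 4 < cos t by apply: le_lt_trans ht; lra.
have h2 : 1 - e / 4 < cos (t *+ m) by apply: hd; apply: le_lt_trans ht; lra.
by have := cos_near1D h1 h2; rewrite mulrC divfK.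
Qed.

End AngularContinuity.

(** * Unimodular scalars *)

Section ComplexScalars.
Variable R : realType.

Lemma expi0 : expi (0 : R) = 1.
Proof. by rewrite /expi cos0 sin0. Qed.

Lemma expiD (a b : R) : expi (a + b) = expi a * expi b.
Proof.
by rewrite /expi cosD sinD; simpc; congr (_ +i* _)%C; rewrite addrC.
Qed.

Lemma norm_expi (a : R) : `|expi a| = 1.
Proof. by rewrite normc_def/= cos2Dsin2 sqrtr1. Qed.

Lemma norm_real_complex (r : R) : `|r%:C%C| = (`|r|%:C)%C :> R[i].
Proof. by rewrite normc_def/= expr0n/= addr0 sqrtr_sqr. Qed.

Lemma real_complex_continuous : continuous (fun r : R => (r%:C)%C : R[i]^o).
Proof.
move=> r; apply/cvgrPdist_lt => e e0.
have re0 : 0 < complex.Re e by move: e0; rewrite ltcE => /andP[].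
have eE : e = ((complex.Re e)%:C)%C by rewrite RRe_real// gtr0_real.
near=> s.
rewrite -rmorphB norm_real_complex eE ltcR.
near: s; have /cvgrPdist_lt := @cvg_id _ (nbhs r); exact.
Unshelve. all: by end_near. Qed.

Lemma expi_continuous : continuous (fun r : R => expi r : R[i]^o).
Proof.
have E r : expi r = ((cos r)%:C + 'i * (sin r)%:C)%C :> R[i] by rewrite [LHS]complexE.
have -> : (fun r : R => expi r : R[i]^o) =
  (fun r => ((cos r)%:C + 'i * (sin r)%:C)%C) by apply/funext => r; exact: E.
move=> r.
apply: (@cvgD _ R[i]^o).
  apply: (@continuous_comp _ _ _ cos (fun r : R => (r%:C)%C : R[i]^o)).
    exact: continuous_cos.
  exact: real_complex_continuous.
apply: cvgM; first exact: cvg_cst.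
apply: (@continuous_comp _ _ _ sin (fun r : R => (r%:C)%C : R[i]^o)).
  exact: continuous_sin.
exact: real_complex_continuous.
Qed.

(** The powers of [r] accumulate at [r ^+ k], if at all, from one side only:
    moving slightly above [r ^+ k] leaves all of them at a definite distance. *)
Lemma power_gap (r : R) k : 0 <= r -> exists2 t0, 0 < t0 &
  forall t n, 0 < t <= t0 -> t <= `|r ^+ n - (r ^+ k + t)|.
Proof.
move=> r0; pose P t0 n := r ^+ n <= r ^+ k \/ r ^+ k + 2 * t0 <= r ^+ n.
suff [t0 t00 H] : exists2 t0, 0 < t0 & forall n, P t0 n.
  exists t0 => // t n /andP[tp tt0]; case: (H n) => h.
    by rewrite ler0_norm; lra.
  by rewrite ger0_norm; lra.
have fin m : exists2 t0, 0 < t0 & forall n, (n < m)%N -> P t0 n.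
  elim: m => [|m [t0 t00 H]]; first by exists 1.
  have [h|h] := leP (r ^+ m) (r ^+ k).
    by exists t0 => // n; rewrite ltnS leq_eqVlt => /predU1P[->|]; [left|exact: H].
  exists (Num.min t0 ((r ^+ m - r ^+ k) / 2)).
    by rewrite lt_min t00 divr_gt0// subr_gt0.
  move=> n; rewrite ltnS leq_eqVlt => /predU1P[->|/H[h'|h']].
  - right; have : Num.min t0 ((r ^+ m - r ^+ k) / 2) <= (r ^+ m - r ^+ k) / 2.
      by rewrite ge_min lexx orbT.
    lra.
  - by left.
  - right; have : Num.min t0 ((r ^+ m - r ^+ k) / 2) <= t0 by rewrite ge_min lexx.
    lra.
have [t0 t00 H] := fin k.+2; exists t0 => // n.
have [nk|nk] := ltnP n k.+2; first exact: H.
have [r1|r1] := leP r 1.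
  by left; apply: ler_wiXn2l => //; apply: leq_trans nk; exact: leqW.
have h : r ^+ k.+1 <= r ^+ n by rewrite ler_weXn2l ?(ltW r1)// ltnW.
case: (H k.+1 (leqnn _)) => h'; last by right; exact: le_trans h' h.
have rk0 : 0 < r ^+ k by rewrite exprn_gt0// (lt_trans ltr01).
by move: h'; rewrite exprS; nra.
Qed.

End ComplexScalars.

(** * Topological vector spaces *)

Section TopologicalModule.
Variables (R : realType) (X : topologicalLmodType R[i]).
Implicit Types (x y z : X) (U V W : set X).

Lemma cvg_lmodD (Z : Type) (F : set_system Z) (f g : Z -> X) x y : Filter F ->
  f @ F --> x -> g @ F --> y -> (f z + g z) @[z --> F] --> x + y.
Proof.
move=> FF fx gy.
exact: (cvg_comp _ _ (cvg_pair fx gy) (@add_continuous X (x, y))).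
Qed.

Lemma cvg_lmodZ (Z : Type) (F : set_system Z) (c : Z -> R[i]^o) (g : Z -> X)
  (a : R[i]^o) y : Filter F ->
  c @ F --> a -> g @ F --> y -> (c z *: g z) @[z --> F] --> a *: y.
Proof.
move=> FF ca gy.
exact: (cvg_comp _ _ (cvg_pair ca gy) (@scale_continuous _ X (a, y))).
Qed.

Lemma scale_continuousl (c : R[i]) : continuous (fun z : X => c *: z).
Proof. by move=> z; apply: cvg_lmodZ; [exact: cvg_cst|exact: cvg_id]. Qed.

Lemma nbhs0_scale (c : R[i]) V : nbhs 0 V -> nbhs 0 [set v | V (c *: v)].
Proof.
by move=> V0; have := @scale_continuousl c 0; rewrite /continuous_at scaler0; exact.
Qed.

Lemma nbhs_segment y z U : nbhs y U ->
  exists2 d : R, 0 < d & forall e, 0 < e < d -> U (y + (e%:C)%C *: z).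
Proof.
have : (y + (e%:C)%C *: z) @[e --> (0 : R)] --> y + (0%:C)%C *: z.
  apply: cvg_lmodD; first exact: cvg_cst.
  apply: cvg_lmodZ; [exact: real_complex_continuous|exact: cvg_cst].
rewrite scale0r addr0 => h /h /nbhs_ballP[d/= d0 dU]; exists d => // e /andP[e0 ed].
by apply: dU; rewrite -ball_normE/= sub0r normrN gtr0_norm.
Qed.

Lemma nbhs_sub y V : nbhs 0 V -> \forall z \near y, V (z - y).
Proof.
move=> V0; have : (z - y) @[z --> y] --> y - y.
  by apply: cvg_lmodD; [exact: cvg_id|exact: cvg_cst].
by rewrite subrr; apply.
Qed.

(** Balanced neighbourhoods are what allows division by scalars of modulus bounded
    below. *)
Lemma nbhs_balanced y U : nbhs y U -> exists V,
  [/\ nbhs 0 V, forall c v, `|c| <= 1 -> V v -> V (c *: v) &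
      forall v, V v -> U (y + v)].
Proof.
move=> yU; have : nbhs 0 [set v | U (y + v)].
  have : (y + v) @[v --> (0 : X)] --> y + 0.
    by apply: cvg_lmodD; [exact: cvg_cst|exact: cvg_id].
  by rewrite addr0; apply.
set W := [set v | _] => W0.
have := @scale_continuous _ X (0, 0) W; rewrite /= scale0r => /(_ W0).
case=> -[B V0] /= [/nbhs_ballP[d/= d0 dB] V00] BV.
have {}BV c v : `|c| < d -> V0 v -> W (c *: v).
  move=> cd vV; apply: (BV (c, v)); split=> //=; apply: dB.
  by rewrite -ball_normE/= sub0r normrN.
pose e : R[i] := d / 2; have e0 : 0 < e by rewrite divr_gt0.
have ed : e < d by rewrite /e ltr_pdivrMr// mulr_natr mulr2n ltrDl.
exists [set u | exists c v, [/\ `|c| <= 1, V0 v & u = (c * e) *: v]]; split.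
- apply: filterS (nbhs0_scale e^-1 V00) => v hv.
  by exists 1, (e^-1 *: v); rewrite normr1 mul1r scalerA divff ?scale1r// gt_eqF.
- move=> c _ c1 [c' [v [c'1 hv ->]]]; exists (c * c'), v.
  by rewrite scalerA mulrA normrM mulr_ile1.
- move=> _ [c [v [c1 hv ->]]]; apply: BV => //.
  by rewrite normrM (gtr0_norm e0) (le_lt_trans _ ed)// ler_piMl// ltW.
Qed.

Lemma dense_closureP (A : set X) : dense A <-> forall y, closure A y.
Proof.
split=> [dA y U /nbhs_interior yU|dA U [y Uy] oU].
  have [|z [Uz Az]] := dA (U°) _ (@open_interior _ U).
    by exists y; exact: (nbhs_singleton yU).
  by exists z; split=> //; exact: nbhs_singleton Uz.
by rewrite setIC; apply: (dA y); apply: open_nbhs_nbhs.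
Qed.

Lemma interior_closure_full (A : set X) : (forall y, closure A y) ->
  (closure A)° !=set0.
Proof.
move=> h; exists 0; rewrite (_ : closure _ = setT) ?interiorT//.
by apply/seteqP; split.
Qed.

Lemma closure_image (f : X -> X) (A B : set X) : continuous f ->
  (forall a, A a -> closure B (f a)) -> forall z, closure A z -> closure B (f z).
Proof.
move=> fc AB z Az U /nbhs_interior fzU.
have [a [Aa Ua]] := Az _ (fc z _ fzU).
exact: AB Aa _ Ua.
Qed.

Definition dense_range (f : X -> X) := forall y, closure (range f) y.

Lemma dense_range_comp (f g : X -> X) : continuous f ->
  dense_range f -> dense_range g -> dense_range (f \o g).
Proof.
move=> fc fd gd y U /nbhs_interior yU.
have [_ [[z _ <-] Uz]] := fd y _ yU.
have [_ [[v _ <-] Uv]] := gd z _ (fc z _ Uz).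
by exists (f (g v)); split => //; exists v.
Qed.

End TopologicalModule.

(** * Polynomials in an operator *)

Section PolynomialAction.
Variables (R : realType) (X : topologicalLmodType R[i]) (T : {linear X -> X}).
Hypothesis T_cont : continuous T.
Implicit Types (p q : {poly R[i]}) (x y z : X).

Definition polyop p y : X := \sum_(i < size p) p`_i *: iter i T y.

Lemma polyop_widen n p y : (size p <= n)%N ->
  polyop p y = \sum_(i < n) p`_i *: iter i T y.
Proof.
move=> pn; rewrite /polyop (big_ord_widen n (fun i => p`_i *: iter i T y) pn).
rewrite [RHS](bigID (fun i : 'I_n => (i < size p)%N))/= [X in _ + X]big1 ?addr0//.
by move=> i; rewrite -leqNgt => h; rewrite nth_default// scale0r.
Qed.

Lemma polyopD p q y : polyop (p + q) y = polyop p y + polyop q y.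
Proof.
pose n := maxn (size p) (size q).
rewrite !(@polyop_widen n) ?leq_maxl ?leq_maxr ?size_polyD// -big_split/=.
by apply: eq_bigr => i _; rewrite coefD scalerDl.
Qed.

Lemma polyopZ c p y : polyop (c *: p) y = c *: polyop p y.
Proof.
rewrite !(@polyop_widen (size p)) ?size_scale_leq// scaler_sumr.
by apply: eq_bigr => i _; rewrite coefZ scalerA.
Qed.

Lemma polyopC c y : polyop c%:P y = c *: y.
Proof. by rewrite (@polyop_widen 1) ?size_polyC ?leq_b1// big_ord1 coefC. Qed.

Lemma polyop1 y : polyop 1 y = y.
Proof. by rewrite -[1]/(1%:P) polyopC scale1r. Qed.

Lemma iter_linear n c y z : iter n T (c *: y + z) = c *: iter n T y + iter n T z.
Proof. by elim: n => //= n ->; rewrite linearP. Qed.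

Lemma polyop_linear p c y z : polyop p (c *: y + z) = c *: polyop p y + polyop p z.
Proof.
rewrite /polyop scaler_sumr -big_split/=; apply: eq_bigr => i _.
by rewrite iter_linear scalerDr !scalerA mulrC.
Qed.

HB.instance Definition _ p := GRing.isLinear.Build R[i] X X *:%R (polyop p) (polyop_linear p).

Lemma iter_continuous n : continuous (iter n T).
Proof.
elim: n => [|n IH] y /=; first exact: cvg_id.
by apply: continuous_comp; [exact: IH|exact: T_cont].
Qed.

Lemma polyop_continuous p : continuous (polyop p).
Proof.
move=> y; rewrite /polyop; apply: cvg_big => [|i _]; first exact: add_continuous.
by apply: cvg_lmodZ; [exact: cvg_cst|exact: iter_continuous].
Qed.

Lemma polyopMX p y : polyop (p * 'X) y = polyop p (T y).
Proof.
rewrite (@polyop_widen (size p).+1); last first.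
  by rewrite (leq_trans (size_polyMleq _ _))// size_polyX addn2.
rewrite big_ord_recl coefMX/= scale0r add0r; apply: eq_bigr => i _.
by rewrite coefMX/= -iterSr.
Qed.

Lemma polyopXM p y : polyop ('X * p) y = T (polyop p y).
Proof.
rewrite mulrC polyopMX /polyop linear_sum; apply: eq_bigr => i _.
by rewrite linearZ/= -iterSr.
Qed.

Lemma polyopM p q y : polyop (p * q) y = polyop p (polyop q y).
Proof.
elim/poly_ind: p q => [|p c IH] q; first by rewrite mul0r -[0]/(0%:P) !polyopC !scale0r.
by rewrite mulrDl -mulrA !polyopD IH polyopXM mul_polyC polyopZ polyopMX polyopC.
Qed.

Lemma polyop_comm p q y : polyop p (polyop q y) = polyop q (polyop p y).
Proof. by rewrite -!polyopM mulrC. Qed.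

Lemma polyopX y : polyop 'X y = T y.
Proof. by rewrite -[LHS]/(polyop 'X y) -['X]mulr1 polyopXM polyop1. Qed.

Lemma polyopXn n y : polyop 'X^n y = iter n T y.
Proof. by elim: n => [|n IH]; rewrite ?expr0 ?polyop1// exprS polyopXM IH. Qed.

(** The orbit under the semigroup generated by [T] and the unimodular scalars. *)
Definition circled_orbit (x : X) : set X :=
  [set z | exists t n, z = expi t *: iter n T x].

Section SomewhereDense.
Variables (x : X).
Hypothesis sd : (closure (circled_orbit x))° !=set0.

(** The closure of a subspace that contains an open set is everything: a vector
    [y] is approximated by difference quotients [(z2 - z1) / e] with [z1] close to
    an interior point [z0] and [z2] close to [z0 + e y]. *)
Lemma poly_orbit_dense y : closure [set polyop q x | q in [set: {poly R[i]}]] y.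
Proof.
move: sd => [z0 /nbhs_interior zC] U yU.
have [d d0 hd] := nbhs_segment y zC.
pose e := d / 2; have e0 : 0 < e by rewrite divr_gt0.
have he : (closure (circled_orbit x))° (z0 + (e%:C)%C *: y) by apply: hd; rewrite /e; lra.
pose c : R[i] := (e%:C)%C; have c0 : c != 0 by rewrite gt_eqF// ltcR.
have : (c^-1 *: (u.1 + (-1) *: u.2)) @[u --> (z0 + c *: y, z0)] -->
    c^-1 *: ((z0 + c *: y) + (-1) *: z0).
  apply: cvg_lmodZ; first exact: cvg_cst.
  apply: cvg_lmodD; first exact: cvg_fst.
  by apply: cvg_lmodZ; [exact: cvg_cst|exact: cvg_snd].
rewrite scaleN1r addrAC subrr add0r scalerA mulVf// scale1r => /(_ _ yU).
case=> -[A B] /= [zA zB] AB.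
have [_ [[t1 [n1 ->]] h1']] := interior_subset he _ zA.
have [_ [[t2 [n2 ->]] h2']] := interior_subset (nbhs_singleton zC) _ zB.
have := AB (_, _) (conj h1' h2') => /= hU.
exists (c^-1 *: (expi t1 *: iter n1 T x + -1 *: (expi t2 *: iter n2 T x))).
split=> //; exists (c^-1 *: (expi t1 *: 'X^n1 - expi t2 *: 'X^n2)) => //.
by rewrite polyopZ -scaleN1r polyopD !polyopZ !polyopXn.
Qed.

(** Modulo the range of [T - a], the operator [T] is multiplication by [a]. *)
Lemma iter_mod_range a n y :
  exists m, iter n T y = a ^+ n *: y + polyop ('X - a%:P) m.
Proof.
elim: n => [|n [m hm]].
  by exists 0; rewrite /= expr0 scale1r linear0 addr0.
have TE v : T v = a *: v + polyop ('X - a%:P) v.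
  by rewrite polyopD polyopX -polyCN polyopC scaleNr addrC subrK.
exists (a ^+ n *: y + T m); rewrite iterS hm linearP/= [polyop _ (_ + T m)]linearP/=.
by rewrite [T y]TE scalerDr scalerA -exprSr -addrA -!polyopX polyop_comm.
Qed.

(** Otherwise [T] would act on the quotient by the closed range as [a], and the
    set of the [expi s * a ^+ n] would be somewhere dense in the scalars.
    Concretely, near [expi t T^k x] there is a vector [expi t T^k x + e u x] whose
    coefficient modulo the range, of modulus [|a|^k + e], is at distance at least
    [e] from that of every [expi s T^n x]; approximating it by such vectors and
    dividing by the difference [b] of the coefficients brings [x] into the
    closure of the range. *)
Lemma range_sub_scalar a : closure (range (polyop ('X - a%:P))) x.
Proof.
move: sd => [z0 /nbhs_interior zC] U xU.
have [_ [[t [k ->]] wC]] := interior_subset (nbhs_singleton zC) _ zC.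
have [V [V0 Vb VU]] := nbhs_balanced xU.
pose Na := complex.Re `|a|; have aE : `|a| = (Na%:C)%C by rewrite RRe_real// normr_real.
have Na0 : 0 <= Na by rewrite -ler0c -aE.
have [t0 t00 gap] := power_gap k Na0.
(* u is a unit vector in the direction of the coefficient of expi t T^k x *)
have [u u1 uE] : exists2 u : R[i], `|u| = 1 & expi t * a ^+ k = `|a ^+ k| * u.
  have [->|a0] := eqVneq (a ^+ k) 0; first by exists 1; rewrite ?normr1// normr0 mulr0 mul0r.
  exists (expi t * a ^+ k / `|a ^+ k|).
    by rewrite !normrM norm_expi mul1r normfV normr_id divff// normr_eq0.
  by rewrite [RHS]mulrC divfK// normr_eq0.
have [d d0 hd] := nbhs_segment (u *: x) (nbhs_interior wC).
pose e := Num.min t0 (d / 2); have e0 : 0 < e by rewrite lt_min t00 divr_gt0.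
have et0 : e <= t0 by rewrite ge_min lexx.
have ed2 : e <= d / 2 by rewrite ge_min lexx orbT.
have he : (closure (circled_orbit x))° (expi t *: iter k T x + (e%:C)%C *: (u *: x)).
  by apply: hd; rewrite e0/=; lra.
pose ec : R[i] := (e%:C)%C; have ec0 : 0 < ec by rewrite ltcR.
have [_ [[s [n ->]] /=]] := interior_subset he _ (nbhs_sub _ (nbhs0_scale ec^-1 V0)).
have [m1 ->] := iter_mod_range a n x; have [m2 ->] := iter_mod_range a k x.
pose b := expi s * a ^+ n - (expi t * a ^+ k + ec * u).
have -> : expi s *: (a ^+ n *: x + polyop ('X - a%:P) m1) -
    (expi t *: (a ^+ k *: x + polyop ('X - a%:P) m2) + (e%:C)%C *: (u *: x)) =
    b *: x + polyop ('X - a%:P) (expi s *: m1 - expi t *: m2).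
  have AC (p q1 r q2 w : X) : p + q1 - (r + q2 + w) = p - (r + w) + (q1 - q2).
    by rewrite !opprD !addrA [p + q1 - r]addrAC [LHS]addrAC [p - r + q1 - w]addrAC.
  by rewrite !scalerDr !scalerA AC linearB/= !linearZ/= scalerBl scalerDl.
set m := expi s *: m1 - _.
have bge : ec <= `|b|.
  apply: le_trans (ler_dist_dist _ _).
  rewrite [`|expi s * _|]normrM norm_expi mul1r uE -mulrDl normrM u1 mulr1 !normrX aE.
  rewrite -!rmorphXn -rmorphD/= !norm_real_complex -rmorphB/= norm_real_complex lecR.
  rewrite [X in _ - X]ger0_norm ?addr_ge0 ?exprn_ge0// ?(ltW e0)//.
  by apply: gap; rewrite e0 et0.
have b0 : b != 0 by rewrite -normr_gt0 (lt_le_trans ec0).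
move=> Vd; exists (polyop ('X - a%:P) (- b^-1 *: m)); split; first by exists (- b^-1 *: m).
have -> : polyop ('X - a%:P) (- b^-1 *: m) =
    x + (- (ec / b)) *: (ec^-1 *: (b *: x + polyop ('X - a%:P) m)).
  rewrite linearZ/= scalerA mulNr mulrAC mulfV ?mul1r ?gt_eqF// scalerDr.
  by rewrite scalerA mulNr mulVf// scaleN1r addrA subrr add0r.
apply: VU; apply: Vb => //; rewrite normrN normrM (gtr0_norm ec0) normfV.
by rewrite ler_pdivrMr ?mul1r// normr_gt0.
Qed.

Lemma range_sub_scalar_dense a : dense_range (polyop ('X - a%:P)).
Proof.
move=> y U /nbhs_interior yU.
have [_ [[q _ <-] Uq]] := poly_orbit_dense yU.
have [_ [[z _ <-] Uz]] := range_sub_scalar a (polyop_continuous Uq).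
by exists (polyop ('X - a%:P) (polyop q z)); split; [exists (polyop q z)|rewrite polyop_comm].
Qed.

(** The scalars are algebraically closed, so [p] is a product of linear factors. *)
Lemma polyop_dense_range p : p != 0 -> dense_range (polyop p).
Proof.
move=> p0; have [s ->] := closed_field_poly_normal p.
have : lead_coef p != 0 by rewrite lead_coef_eq0.
elim: s (lead_coef p) => [|a s IH] c c0.
  rewrite big_nil => y U yU; exists y; split; last exact: nbhs_singleton yU.
  exists (c^-1 *: y) => //.
  by rewrite alg_polyC polyopC scalerA mulfV// scale1r.
rewrite big_cons scalerAr.
have -> : polyop (('X - a%:P) * (c *: \prod_(j <- s) ('X - j%:P))) =
    polyop ('X - a%:P) \o polyop (c *: \prod_(j <- s) ('X - j%:P)).
  by apply/funext => y; rewrite polyopM.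
apply: dense_range_comp; [exact: polyop_continuous|exact: range_sub_scalar_dense|].
exact: IH.
Qed.

End SomewhereDense.
End PolynomialAction.

(** * From somewhere dense to dense *)

Section SomewhereDenseIsDense.
Variables (R : realType) (X : topologicalLmodType R[i]) (T : {linear X -> X}).
Hypothesis T_cont : continuous T.
Implicit Types (p q : {poly R[i]}) (x y z : X).

Local Notation C x := (closure (circled_orbit T x)).

Lemma circled_self y : C y y.
Proof. by apply: subset_closure; exists 0, 0%N; rewrite expi0 scale1r. Qed.

Lemma circled_rot s y z : C y z -> C y (expi s *: z).
Proof.
apply: closure_image; first exact: scale_continuousl.
move=> _ [t [n ->]]; apply: subset_closure; exists (s + t), n.
by rewrite scalerA expiD.
Qed.

Lemma circled_polyop p y z : C y z -> C (polyop T p y) (polyop T p z).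
Proof.
apply: closure_image; first exact: polyop_continuous.
move=> _ [t [n ->]]; apply: subset_closure; exists t, n.
by rewrite linearZ/= -!polyopXn polyop_comm.
Qed.

Lemma circled_iter n y z : C y z -> C y (iter n T z).
Proof.
apply: closure_image; first exact: iter_continuous.
move=> _ [t [m ->]]; apply: subset_closure; exists t, (n + m)%N.
by rewrite iterD -!polyopXn linearZ.
Qed.

Lemma circled_trans x y : C x y -> C y `<=` C x.
Proof.
move=> xy; apply: (closure_image (f := id)); first by move=> ?; exact: cvg_id.
by move=> _ [t [n ->]]; apply: circled_rot; exact: circled_iter.
Qed.

Lemma interior_rot s y z : (C y)° z -> (C y)° (expi s *: z).
Proof.
move=> h; have : nbhs (expi (- s) *: (expi s *: z)) (C y).
  by rewrite scalerA -expiD addNr expi0 scale1r.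
move=> /scale_continuousl h'.
have {}h' : nbhs (expi s *: z) [set v | C y (expi (- s) *: v)] := h'.
apply: filterS h' => v /(@circled_rot s) /=.
by rewrite scalerA -expiD subrr expi0 scale1r.
Qed.

(** Dropping the first circle of the circled orbit loses no interior.  If it did,
    all small dilates of [x] would be limits of unimodular multiples of [x]; this
    forces [x] into every neighbourhood of [0], and then [T x] is
    indistinguishable from the multiples of [x], so nothing was lost after all.
    The space need not be separated, which is why this degenerate case has to be
    treated. *)
Lemma interior_circledT x : (C x)° `<=` C (T x).
Proof.
move=> w wC; apply: contrapT => wT.
pose W := (C x)° `&` ~` C (T x).
have oW : open W by apply: openI; [exact: open_interior|exact/closed_openC/closed_closure].
have noT t n : W (expi t *: iter n T x) -> n = 0%N.
  case: n => // n [_]; rewrite iterSr => h; exfalso; apply: h.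
  by apply: subset_closure; exists t, n.
have Ww : W w by [].
have [_ [[t [n ->]] Wt]] := interior_subset wC _ (open_nbhs_nbhs (conj oW Ww)).
have n0 := noT _ _ Wt; rewrite n0/= {n n0} in Wt.
have [d d0 hd] := nbhs_segment (expi t *: x) (open_nbhs_nbhs (conj oW Wt)).
pose e := d / 2; have e0 : 0 < e by rewrite divr_gt0.
have We : W (expi t *: x + (e%:C)%C *: (expi t *: x)) by apply: hd; rewrite /e; lra.
pose ec : R[i] := (e%:C)%C; have ec0 : 0 < ec by rewrite ltcR.
have x0 V : nbhs 0 V -> V x.
  move=> /nbhs_balanced[V1 [V10 V1b V1V]].
  have nW := open_nbhs_nbhs (conj oW We).
  have [_ [[s [n ->]] [Wn]]] :=
    interior_subset We.1 _ (filterI nW (nbhs_sub _ (nbhs0_scale ec^-1 V10))).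
  rewrite (noT _ _ Wn)/= -/ec.
  pose b := expi s - (1 + ec) * expi t.
  have -> : expi s *: x - (expi t *: x + ec *: (expi t *: x)) = b *: x.
    by rewrite /b scalerBl mulrDl mul1r scalerDl scalerA.
  have bge : ec <= `|b|.
    apply: le_trans (ler_dist_dist _ _).
    rewrite normrM !norm_expi mulr1 ger0_norm ?addr_ge0// ?(ltW ec0)//.
    by rewrite opprD addrA subrr add0r normrN (gtr0_norm ec0).
  have b0 : b != 0 by rewrite -normr_gt0 (lt_le_trans ec0).
  have cb1 : `|ec / b| <= 1.
    by rewrite normrM (gtr0_norm ec0) normfV ler_pdivrMr ?mul1r// normr_gt0.
  move=> /(V1b _ _ cb1); rewrite !scalerA mulrA mulrAC divfK// mulfV ?gt_eqF// scale1r.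
  by move=> /V1V; rewrite add0r.
apply: Wt.2 => U /nbhs_balanced[V [V0 _ VU]]; exists (T x); split.
  by exists 0, 0%N; rewrite expi0 scale1r.
have -> : T x = expi t *: x + (T x - expi t *: x) by rewrite addrC subrK.
apply: VU; apply: (x0 [set v | V (T v - expi t *: v)]).
have : (T v - expi t *: v) @[v --> (0 : X)] --> T 0 - expi t *: (0 : X).
  apply: cvg_lmodD; first exact: T_cont.
  by apply: continuous_comp; [exact: scale_continuousl|exact: opp_continuous].
by rewrite linear0 scaler0 subrr; apply.
Qed.

Lemma interior_circled_iter k x : (C x)° `<=` (C (iter k T x))°.
Proof.
elim: k => [//|k IH] z /IH zC /=.
exact: filterS (@interior_circledT (iter k T x)) (nbhs_interior zC).
Qed.

(** Let [U] be the interior of [C x].  The segment from [x] to [q(T) x], with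
    [q(1) = 1], consists of vectors [p(T) x] with [p(1) = 1], for which membership
    in the open set [U] and in the closed set [C x] are equivalent ([CU]).  By
    connectedness it lies in [U]. *)
Lemma circled_dense_of_nbhs x : (C x)° x -> forall y, C x y.
Proof.
move=> xC; have sd : (C x)° !=set0 by exists x.
have xT : C (T x) x by exact: interior_circledT.
pose U := (C x)°; have oU : open U by exact: open_interior.
have sC : U `<=` C x by exact: interior_subset.
(* if T y is in U and y is not, then some q(T) x near y is outside C x while
   T q(T) x is in C x; but x is in C (T x), so q(T) x is in C (T q(T) x) *)
have UT y : U (T y) -> U y.
  move=> TyU; have : nbhs y ((T @^-1` U)°).
    by apply: nbhs_interior; apply: T_cont; exact: open_nbhs_nbhs.
  apply: filterS => z zN; apply: contrapT => zC.
  have zN' : nbhs z ((T @^-1` U) `&` ~` C x).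
    apply: filterI => //; apply: open_nbhs_nbhs; split=> //.
    exact/closed_openC/closed_closure.
  have [_ [[q _ <-] [TqU]]] := poly_orbit_dense sd zN'; apply.
  apply: (circled_trans (sC _ TqU)).
  by rewrite -polyopX polyop_comm polyopX; exact: circled_polyop.
have UC y : ~ U y -> forall z, C y z -> ~ U z.
  move=> yU z yz zU; have [_ [[t [n ->]]]] := yz _ (open_nbhs_nbhs (conj oU zU)).
  move=> /(interior_rot (- t)); rewrite scalerA -expiD addNr expi0 scale1r => h.
  by apply: yU; elim: n h => // n IH /UT.
(* a vector p(T) x in C x but not in U would make p(T) map the dense set of all
   q(T) x into the complement of U, although the range of p(T) is dense *)
have CU p : p.[1] = 1 -> C x (polyop T p x) -> U (polyop T p x).
  move=> p1 pC; apply: contrapT => pU.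
  have p0 : p != 0 by apply: contra_eq_neq p1 => ->; rewrite horner0 eq_sym oner_eq0.
  have H q : ~ U (polyop T p (polyop T q x)).
    have [qU|qU] := pselect (U (polyop T q x)).
      by apply: (UC _ pU); apply: circled_polyop; exact: sC.
    by apply: (UC _ qU); rewrite polyop_comm; exact: circled_polyop.
  have [_ [[z _ <-] zU]] := polyop_dense_range T_cont sd p0 (open_nbhs_nbhs (conj oU xC)).
  have [_ [[q _ <-] qU]] :=
    poly_orbit_dense sd (polyop_continuous T_cont (open_nbhs_nbhs (conj oU zU))).
  exact: H qU.
have AU q : q.[1] = 1 -> U (polyop T q x).
  move=> q1; pose g (s : R) := x + (s%:C)%C *: (polyop T q x - x).
  have gE s : g s = polyop T (1 + (s%:C)%C *: (q - 1)) x.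
    by rewrite polyopD polyopZ polyopD polyop1 -scaleN1r polyopZ polyop1 scaleN1r.
  have gc : continuous g.
    move=> s; apply: cvg_lmodD; first exact: cvg_cst.
    apply: cvg_lmodZ; [exact: real_complex_continuous|exact: cvg_cst].
  have E : `[0, 1]%classic `&` (g @^-1` U) = `[0, 1]%classic.
    apply: (@segment_connected R 0 1).
    - exists 0; split; first by rewrite /= in_itv/= lexx ler01.
      by rewrite /= /g scale0r addr0.
    - by exists (g @^-1` U) => //; apply: open_comp => // ? _; exact: gc.
    - exists (g @^-1` C x).
        by apply: closed_comp => [? _|]; [exact: gc|exact: closed_closure].
      congr (_ `&` _); apply/seteqP; split=> s /=; first exact: sC.
      rewrite gE; apply: CU.
      by rewrite !hornerE q1 subrr mulr0 addr0.
  have : (`[0, 1]%classic `&` (g @^-1` U)) 1 by rewrite E /= in_itv/= lexx ler01.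
  by case=> _; rewrite /= /g scale1r addrC subrK.
move=> y; have /closure_id -> := @closed_closure _ (circled_orbit T x).
move=> N yN.
have x1 : 'X - 1%:P != 0 :> {poly R[i]} by rewrite polyXsubC_eq0.
have N1 : nbhs (y - x) [set z | N° (x + z)].
  have : (x + z) @[z --> y - x] --> x + (y - x).
    by apply: cvg_lmodD; [exact: cvg_cst|exact: cvg_id].
  by rewrite [x + (y - x)]addrC subrK => /(_ _ (nbhs_interior yN)).
have [_ [[z _ <-] zU]] := polyop_dense_range T_cont sd x1 N1.
have N2 : nbhs z [set z | N (x + polyop T ('X - 1%:P) z)].
  have : (x + polyop T ('X - 1%:P) v) @[v --> z] --> x + polyop T ('X - 1%:P) z.
    by apply: cvg_lmodD; [exact: cvg_cst|exact: polyop_continuous].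
  exact.
have [_ [[q _ <-] qU]] := poly_orbit_dense sd N2.
exists (x + polyop T ('X - 1%:P) (polyop T q x)); split=> //; apply: sC.
have -> : x + polyop T ('X - 1%:P) (polyop T q x) = polyop T (1 + ('X - 1%:P) * q) x.
  by rewrite [RHS]polyopD polyop1 polyopM.
by apply: AU; rewrite !hornerE subrr mul0r addr0.
Qed.

Lemma somewhere_dense_circled x : (C x)° !=set0 -> forall y, C x y.
Proof.
move=> [z zC]; have [_ [[t [k ->]]]] := interior_subset zC _ (nbhs_interior zC).
move=> /(@interior_circled_iter k) /(interior_rot (- t)).
rewrite scalerA -expiD addNr expi0 scale1r => h y.
apply: (@circled_trans x (iter k T x) _ _ (@circled_dense_of_nbhs _ h y)).
by apply: circled_iter; exact: circled_self.
Qed.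

End SomewhereDenseIsDense.
(** * Limit phases *)

Section ClusterPhases.
Variables (R : realType) (X : topologicalLmodType R[i]) (T : {linear X -> X}).
Hypothesis T_cont : continuous T.
Variables (I : Type) (op : I -> I -> I) (a : I -> {poly R[i]}).
Hypothesis aM : forall i j, a (op i j) = a i * a j.
Variable G : set_system I.
Hypothesis PG : ProperFilter G.
Hypothesis Gop : forall B, G B -> \forall i \near G, \forall j \near G, B (op i j).
Variable u : I -> R.
Hypothesis uD : forall i e, 0 < e ->
  \forall j \near G, 1 - e < cos (u (op i j) - u i - u j).
Implicit Types (p q : {poly R[i]}) (x y z : X).

(** The angles [t] such that [(a_i(T) y, u_i)] clusters at [(z, t)] along [G], the
    second coordinate being taken modulo [2 pi]. *)
Definition phases y z : set R := [set t | forall U B e,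
  nbhs z U -> G B -> 0 < e ->
  exists i, [/\ B i, U (polyop T (a i) y) & 1 - e < cos (u i - t)]].

(** Compose a return from [y] to [z] with one from [z] to [v].  The outer time [i]
    is chosen first, then [j] far along the filter depending on [i]; [Gop] and
    [uD] are the conditions that make [op i j] a good return time. *)
Lemma phasesD y z v s t : phases y z s -> phases z v t -> phases y v (s + t).
Proof.
move=> ys zt U B e /nbhs_interior vU GB e0.
have e40 : 0 < e / 16 by rewrite divr_gt0.
have [i [Bi Ui ui]] := zt _ _ _ vU (Gop GB) e40.
have [j [[Bj cj] Uj uj]] :=
  ys _ _ _ (polyop_continuous T_cont Ui) (filterI Bi (uD i e40)) e40.
exists (op i j); split=> //; first by rewrite aM polyopM.
have h := cos_near1D ui uj; have h' : 1 - 4 * (e / 16) < cos (u (op i j) - u i - u j).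
  by apply: le_lt_trans cj; lra.
have := cos_near1D h' h.
rewrite (_ : _ + _ = u (op i j) - (s + t)); last by ring.
by apply: le_lt_trans; lra.
Qed.

Lemma phases_polyop p y z : phases y z `<=` phases (polyop T p y) (polyop T p z).
Proof.
move=> t yt U B e zU GB e0.
have [i [Bi Ui ui]] := yt _ _ _ (polyop_continuous T_cont zU) GB e0.
by exists i; split=> //; rewrite polyop_comm.
Qed.

Lemma phases_closed y z t :
  (forall e, 0 < e -> exists2 s, phases y z s & 1 - e < cos (s - t)) -> phases y z t.
Proof.
move=> h U B e zU GB e0; have e40 : 0 < e / 4 by rewrite divr_gt0.
have [s ys st] := h _ e40; have [i [Bi Ui ui]] := ys _ _ _ zU GB e40.
exists i; split=> //; have := cos_near1D ui st; rewrite addrA subrK.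
by rewrite mulrC divfK.
Qed.

Lemma phases_target_closed y z t :
  (forall U, nbhs z U -> exists2 v, U v & phases y v t) -> phases y z t.
Proof.
move=> h U B e /nbhs_interior zU GB e0.
by have [v vU vt] := h _ zU; exact: vt.
Qed.

Definition reaches y := forall z U B, nbhs z U -> G B ->
  exists2 i, B i & U (polyop T (a i) y).

Lemma reaches_polyop p y : dense_range (polyop T p) -> reaches y -> reaches (polyop T p y).
Proof.
move=> pd yr z U B /nbhs_interior zU GB.
have [_ [[v _ <-] Uv]] := pd z _ zU.
have [i Bi Ui] := yr _ _ _ (polyop_continuous T_cont Uv) GB.
by exists i => //; rewrite polyop_comm.
Qed.

Lemma phases_nonempty y z : reaches y -> phases y z !=set0.
Proof.
move=> yr; pose F : set_system I := [set A | exists U B, [/\ nbhs z U, G B &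
  forall i, B i -> U (polyop T (a i) y) -> A i]].
have FF : Filter F.
  split.
  - by exists setT, setT; split=> //; exact: filterT.
  - move=> A1 A2 [U1 [B1 [zU1 GB1 h1]]] [U2 [B2 [zU2 GB2 h2]]].
    exists (U1 `&` U2), (B1 `&` B2); split; [exact: filterI|exact: filterI|].
    by move=> i [b1 b2] [v1 v2]; split; [exact: h1|exact: h2].
  - move=> A1 A2 A12 [U [B [zU GB h]]]; exists U, B; split=> // i Bi Ui.
    by apply: A12; exact: h.
have PF : ProperFilter F.
  apply: Build_ProperFilter_ex => A [U [B [zU GB h]]].
  by have [i Bi Ui] := yr _ _ _ zU GB; exists i; exact: h.
have [t ht] := @cluster_angle R I F u PF; exists t => U B e zU GB e0.
have [|i [Bi Ui] ui] := ht e (B `&` [set i | U (polyop T (a i) y)]) e0; last by exists i.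
by exists U, B; split.
Qed.

Variable x : X.
Hypothesis x_reaches : reaches x.
Hypothesis dr : forall p, p != 0 -> dense_range (polyop T p).

(** In the second case [w p] is [m] times any element of [phases x (p(T) x)]; this
    is well defined modulo [2 pi] because composing with a return from [p(T) x] to
    [x], which exists since [p(T)] has dense range, puts the difference of two
    such elements in [phases x x].  Continuity of [w] for the topology of [X], not
    of polynomials, comes from the closedness of the graph of [phases] and the
    compactness of the circle. *)
Lemma phases_dichotomy : (forall y, phases x y 0) \/
  exists m w, [/\ (0 < m)%N,
    forall p q, p != 0 -> q != 0 -> cos (w (p * q) - (w p + w q)) = 1,
    forall p e, p != 0 -> 0 < e -> exists2 U, nbhs (polyop T p x) U &
      forall q, U (polyop T q x) -> 1 - e < cos (w q - w p),
    forall p, p != 0 -> cos (w p) = 1 -> phases x (polyop T p x) 0 &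
    forall p t, p != 0 -> phases x (polyop T p x) t -> cos (w p - t *+ m) = 1].
Proof.
have ne y := phases_nonempty y x_reaches.
have [|||full|[m m0 Hm]] := @closed_angle_subgroup R (phases x x).
- by move=> s t; exact: phasesD.
- by move=> t; exact: phases_closed.
- exact: ne.
- left=> y; have [t yt] := ne y; rewrite -(addNr t).
  exact: phasesD (full _) yt.
right; pose th p := xget 0 (phases x (polyop T p x)).
have thP p : phases x (polyop T p x) (th p) by apply: xgetPex; exact: ne.
have coset p s t : p != 0 -> phases x (polyop T p x) s -> phases x (polyop T p x) t ->
    cos ((s - t) *+ m) = 1.
  move=> p0 ps pt.
  have [v pv] := phases_nonempty x (reaches_polyop (dr p0) x_reaches).
  have /Hm h1 := phasesD ps pv; have /Hm h2 := phasesD pt pv.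
  have -> : s - t = (s + v) - (t + v) by ring.
  by rewrite mulrnBl cos1D// cosN.
exists m, (fun p => th p *+ m); split => //.
- move=> p q p0 q0; rewrite -mulrnDl -mulrnBl; apply: (@coset (p * q)).
  + by rewrite mulf_neq0.
  + exact: thP.
  + rewrite mulrC polyopM [th p + _]addrC; apply: phasesD (thP q) _.
    exact: phases_polyop.
- move=> p e p0 e0; apply: contrapT => bad.
  (* a cluster point t of th along the q that violate continuity at p *)
  pose F : set_system {poly R[i]} := [set A | exists2 U, nbhs (polyop T p x) U &
    forall q, U (polyop T q x) -> cos (th q *+ m - th p *+ m) <= 1 - e -> A q].
  have FF : Filter F.
    split.
    - by exists setT => //; exact: filterT.
    - move=> A1 A2 [U1 zU1 h1] [U2 zU2 h2]; exists (U1 `&` U2); first exact: filterI.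
      by move=> q [v1 v2] hq; split; [exact: h1|exact: h2].
    - move=> A1 A2 A12 [U zU h]; exists U => // q Uq hq; apply: A12; exact: h.
  have PF : ProperFilter F.
    apply: Build_ProperFilter_ex => A [U zU h].
    apply: contrapT => noA; apply: bad; exists U => // q Uq.
    by rewrite ltNge; apply/negP => hq; apply: noA; exists q; exact: h.
  have [t ht] := @cluster_angle R _ F th PF.
  have pt : phases x (polyop T p x) t.
    move=> U B d /nbhs_interior zU GB d0; have d40 : 0 < d / 4 by rewrite divr_gt0.
    have [|q Uq qt] := ht (d / 4) [set q | U° (polyop T q x)] d40.
      by exists U°.
    have [i [Bi Ui ui]] := thP q _ _ _ Uq GB d40.
    exists i; split=> //; have := cos_near1D ui qt; rewrite addrA subrK.
    by rewrite mulrC divfK.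
  have c1 := coset _ _ _ p0 pt (thP p).
  have [d d0 hd] := cosMn_near m e0.
  have [|q qbad /hd] := ht d [set q | cos (th q *+ m - th p *+ m) <= 1 - e] d0.
    by exists setT => //; exact: filterT.
  rewrite -(@cos1_transfer _ (th q *+ m - th p *+ m)); first by rewrite ltNge qbad.
  rewrite -!mulrnBl (_ : th q - th p - (th q - t) = t - th p)//; ring.
- move=> p p0 /Hm /= h.
  have h' : phases x x (- th p) by apply/Hm; rewrite mulNrn cosN; apply/Hm.
  by rewrite -(addNr (th p)); exact: phasesD h' (thP p).
- by move=> p t p0 pt; rewrite -mulrnBl; exact: coset p0 (thP p) pt.
Qed.

End ClusterPhases.
(** * Removing unimodular factors *)

Section Rotations.
Variables (R : realType) (X : topologicalLmodType R[i]) (T : {linear X -> X}).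
Hypothesis T_cont : continuous T.
Implicit Types (p q : {poly R[i]}).
Variable x : X.

Lemma expi_near1 (d : R[i]) : 0 < d ->
  exists2 e : R, 0 < e & forall t, 1 - e < cos t -> `|expi t - 1| < d.
Proof.
move=> d0; have dE : d = ((complex.Re d)%:C)%C by rewrite RRe_real// gtr0_real.
set r := complex.Re d in dE; have r0 : 0 < r by rewrite dE ltcR in d0.
exists (r ^+ 2 / 2); first by rewrite divr_gt0// exprn_gt0.
move=> t ht; rewrite dE normc_def ltcR -[ltRHS]gtr0_norm// -sqrtr_sqr.
rewrite ltr_sqrt ?exprn_gt0//=; have := cos2Dsin2 t; rewrite subr0 => ct; nra.
Qed.

Lemma nbhs_rotation (y : X) U : nbhs y U -> exists2 e : R, 0 < e &
  exists2 V, nbhs y V & forall t v, 1 - e < cos t -> V v -> U (expi t *: v).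
Proof.
move=> yU; have := @scale_continuous _ X (1, y) U; rewrite /= scale1r => /(_ yU).
case=> -[B V] /= [/nbhs_ballP[d/= d0 dB] yV] BV.
have [e e0 he] := expi_near1 d0; exists e => //; exists V => // t v te Vv.
apply: (BV (expi t, v)); split=> //=; apply: dB.
by rewrite -ball_normE/= distrC he.
Qed.

Lemma weight_continuous (Z : topologicalType) (w : {poly R[i]} -> R)
    (f : Z -> {poly R[i]}) :
  (forall p e, p != 0 -> 0 < e -> exists2 U, nbhs (polyop T p x) U &
      forall q, U (polyop T q x) -> 1 - e < cos (w q - w p)) ->
  (forall z, f z != 0) -> continuous (fun z => polyop T (f z) x) ->
  angle_continuous (w \o f).
Proof.
move=> wc f0 fc z e e0; have [U fU hU] := wc _ _ (f0 z) e0.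
have fz : nbhs z [set v | U (polyop T (f v) x)] := fc z _ fU.
by apply: filterS fz => v; exact: hU.
Qed.

Section LeonMuller.
Hypothesis xd : forall y, closure (circled_orbit T x) y.

Lemma circled_reaches (y : X) U : nbhs y U ->
  exists t n, U (expi t *: iter n T x).
Proof. by move=> yU; have [_ [[t [n ->]] ?]] := xd yU; exists t, n. Qed.

Let sd : (closure (circled_orbit T x))° !=set0.
Proof. exact: interior_closure_full. Qed.

Let I := (nat * R)%type.
Let op (i j : I) : I := ((i.1 + j.1)%N, i.2 + j.2).
Let a (i : I) : {poly R[i]} := expi i.2 *: 'X^(i.1).

Lemma polyop_rotated_power (i : I) y : polyop T (a i) y = expi i.2 *: iter i.1 T y.
Proof. by rewrite polyopZ polyopXn. Qed.

(** The family is [expi t *: T^n], indexed by the pairs [(n, t)] with the trivial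
    filter, and the phase is [t] itself. *)
Lemma circled_phase0 y : phases T a (globally setT) snd x y 0.
Proof.
have aM i j : a (op i j) = a i * a j.
  by rewrite /a /op/= expiD exprD -scalerAl -scalerAr scalerA.
have PG : ProperFilter (globally [set: I]) by exact: (@globally_properfilter _ _ (0%N, 0)).
have Gop (B : set I) : globally setT B -> \forall i \near globally setT,
  \forall j \near globally setT, B (op i j) by move=> BT i _ j _; exact: BT.
have uD (i : I) e : 0 < e ->
    \forall j \near globally [set: I], 1 - e < cos ((op i j).2 - i.2 - j.2).
  by move=> e0 j _ /=; rewrite addrAC addrK subrr cos0; lra.
have xr : reaches T a (globally setT) x.
  move=> z U B zU GB; have [t [n h]] := circled_reaches zU.
  by exists (n, t); [exact: GB|rewrite polyop_rotated_power].
have [h|[m [w [m0 wM wc w1 wt]]]] := phases_dichotomy T_cont aM PG Gop uD xr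
  (polyop_dense_range T_cont sd); first exact: h.
exfalso.
have expi_neq0 t : (expi t)%:P != 0 :> {poly R[i]}.
  by rewrite polyC_eq0 -normr_eq0 norm_expi oner_eq0.
have wexpi t : cos (w (expi t)%:P - t *+ m) = 1.
  have [s xs] := phases_nonempty PG snd x xr.
  have h1 : phases T a (globally setT) snd x (polyop T (expi t)%:P x) (s + t).
    move=> U B e /nbhs_interior zU GB e0.
    have zU' : nbhs x [set v | U (expi t *: v)].
      by apply: scale_continuousl; rewrite -(polyopC T); exact: interior_subset zU.
    have [[n r] [_ Ui ui]] := xs _ _ _ zU' GB e0.
    exists (n, t + r); split; [exact: GB| |].
      by move: Ui; rewrite !polyop_rotated_power/= scalerA expiD.
    by rewrite /= (_ : t + r - (s + t) = r - s)//; ring.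
  have w10 : cos (w 1) = 1.
    have := wM 1 1 (oner_neq0 _) (oner_neq0 _).
    by rewrite mulr1 opprD addrA subrr add0r cosN.
  have c1 : cos (s *+ m) = 1.
    have := wt 1 s (oner_neq0 _); rewrite polyop1 => /(_ xs) c1.
    by rewrite -(cos1_transfer c1).
  have c2 := wt _ _ (expi_neq0 t) h1.
  have -> : w (expi t)%:P - t *+ m = w (expi t)%:P - (s + t) *+ m + s *+ m.
    by rewrite mulrnDl; ring.
  exact: cos1D.
(* for r from 0 to 1 the loop of constants moves, through nonzero polynomials, to
   the constant loop at the variable *)
pose f (z : R * R) : {poly R[i]} :=
  ((1 - z.2)%:C)%C *: (expi (pi *+ 2 * z.1))%:P + (z.2%:C)%C *: 'X.
have f0 z : f z != 0.
  apply/negP => /eqP fz0.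
  have c1 : (f z)`_1 = (z.2%:C)%C by rewrite /f !coefE/= mulr0 add0r mulr1.
  have c0 : (f z)`_0 = ((1 - z.2)%:C)%C * expi (pi *+ 2 * z.1).
    by rewrite /f !coefE/= mulr0 addr0.
  move: c1 c0; rewrite fz0 !coef0 => /esym [z20]; rewrite z20 subr0 mul1r => /esym/eqP.
  by rewrite -normr_eq0 norm_expi oner_eq0.
have fc : continuous (fun z => polyop T (f z) x).
  have -> : (fun z => polyop T (f z) x) = fun z : R * R =>
      ((1 - z.2)%:C)%C *: (expi (pi *+ 2 * z.1) *: x) + (z.2%:C)%C *: T x.
    by apply/funext => z; rewrite polyopD !polyopZ polyopC polyopX.
  move=> z; apply: cvg_lmodD.
    apply: cvg_lmodZ.
      apply: (@continuous_comp _ _ _ (fun z : R * R => 1 - z.2)); last first.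
        exact: real_complex_continuous.
      by apply: cvgB; [exact: cvg_cst|exact: cvg_snd].
    apply: cvg_lmodZ; last exact: cvg_cst.
    apply: (@continuous_comp _ _ _ (fun z : R * R => pi *+ 2 * z.1)); last first.
      exact: expi_continuous.
    by apply: cvgM; [exact: cvg_cst|exact: cvg_fst].
  apply: cvg_lmodZ; last exact: cvg_cst.
  apply: (@continuous_comp _ _ _ (fun z : R * R => z.2)); last first.
    exact: real_complex_continuous.
  exact: cvg_snd.
have [g [gc g1 _ gE]] := angle_lift (weight_continuous wc f0 fc).
have g01 : g 0 = g 1.
  by apply: gE => r; rewrite /= /f mulr0 mulr1 /expi cos0 sin0 cos2pi sin2pi.
pose h s := g s - (w 'X - (pi *+ 2 * s) *+ m).
have : h 0 = h 1.
  apply: cos1_constant.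
  - move=> s s01; apply: cvgB; first exact: gc.
    apply: cvgB; first exact: cvg_cst.
    have -> : (fun s => (pi *+ 2 * s) *+ m) = fun s : R => (pi *+ 2 *+ m) * s.
      by apply/funext => r; rewrite -mulrnAl.
    by rewrite -mulrnAl; exact: (@mulrl_continuous R (pi *+ 2 *+ m) s).
  - move=> s s01; have := g1 s s01.
    rewrite /comp /f/= subrr subr0 rmorph0 rmorph1 !scale0r !scale1r add0r addr0.
    move=> c1; have c2 : cos (- (w (expi (pi *+ 2 * s))%:P - (pi *+ 2 * s) *+ m)) = 1.
      by rewrite cosN wexpi.
    by rewrite -(cos1D c1 c2) /h; congr cos; ring.
rewrite /h g01 mulr0 mul0rn subr0 mulr1 => /addrI/oppr_inj/eqP.
rewrite -subr_eq0 opprB addrC subrK mulrn_eq0 (gtn_eqF m0)/= mulrn_eq0/=.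
by rewrite gt_eqF// pi_gt0.
Qed.

(** Since the phase [0] is reached, [y] is a limit of vectors [expi t *: T^n x]
    with [expi t] close to [1]. *)
Lemma dense_orbit_of_circled y : closure [set iter n T x | n in [set: nat]] y.
Proof.
move=> U yU; have [e e0 [V yV VU]] := nbhs_rotation yU.
have GT : globally [set: I] setT by [].
have [[n t] [_ Vi ti]] := circled_phase0 yV GT e0.
exists (iter n T x); split; first by exists n.
move: Vi; rewrite polyop_rotated_power/= => Vi.
have := VU (- t) _ _ Vi; rewrite scalerA -expiD addNr expi0 scale1r; apply.
by move: ti; rewrite /= subr0 cosN.
Qed.

End LeonMuller.
End Rotations.
(** * Phases along the plain orbit *)

Section AdditiveCase.
Variables (R : realType) (X : topologicalLmodType R[i]) (T : {linear X -> X}).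
Hypothesis T_cont : continuous T.
Implicit Types (p q : {poly R[i]}).
Variable x : X.
Hypothesis xd : forall y : X, closure [set iter n T x | n in [set: nat]] y.

Lemma dense_circled y : closure (circled_orbit T x) y.
Proof.
apply: closure_subset (xd (y := y)) => _ [n _ <-].
by exists 0, n; rewrite expi0 scale1r.
Qed.

Let sd : (closure (circled_orbit T x))° !=set0.
Proof. by apply: interior_closure_full => y; exact: dense_circled. Qed.

Section Phases.
Variable G : set_system nat.
Hypothesis PG : ProperFilter G.
Hypothesis Goo : forall N, \forall n \near G, (N <= n)%N.
Hypothesis Gop : forall B, G B -> \forall i \near G, \forall j \near G, B (i + j)%N.
Variable u : nat -> R.
Hypothesis uD : forall i e, 0 < e ->
  \forall j \near G, 1 - e < cos (u (i + j)%N - u i - u j).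
Hypothesis xr : forall (y : X) U B, nbhs y U -> G B ->
  exists2 n, B n & U (iter n T x).

Let a n : {poly R[i]} := 'X^n.

(** Here [c s] runs through the segment from [1] to the variable, [f n (s, .)]
    through the segment from [1] to [c s ^+ n], and [g1 1] is the angle swept by
    the weight [w] along the first of these.  All these polynomials take the value
    [1] at [1], hence do not vanish. *)
Lemma orbit_phase0 y : phases T a G u x y 0.
Proof.
have aM i j : a (i + j)%N = a i * a j by rewrite /a exprD.
have xr' : reaches T a G x.
  by move=> z U B zU GB; have [n Bn Un] := xr zU GB; exists n => //; rewrite polyopXn.
have [h|[m [w [m0 wM wc w1 _]]]] := phases_dichotomy T_cont aM PG Gop uD xr'
  (polyop_dense_range T_cont sd); first exact: h.
have w10 : cos (w 1) = 1.
  have := wM 1 1 (oner_neq0 _) (oner_neq0 _).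
  by rewrite mulr1 opprD addrA subrr add0r cosN.
have wX p n : p != 0 -> cos (w (p ^+ n) - w p *+ n) = 1.
  move=> p0; elim: n => [|n IH]; first by rewrite expr0 mulr0n subr0.
  have := cos1D (wM _ _ p0 (expf_neq0 n p0)) IH; rewrite exprS mulrS; congr (cos _ = _).
  ring.
pose c (s : R) : {poly R[i]} := 1 + (s%:C)%C *: ('X - 1).
pose f n (z : R * R) : {poly R[i]} := 1 + (z.2%:C)%C *: (c z.1 ^+ n - 1).
have c1 s : (c s).[1] = 1 by rewrite /c !hornerE subrr mulr0 addr0.
have c0 s : c s != 0.
  by apply: contra_eq_neq (c1 s) => ->; rewrite horner0 eq_sym oner_eq0.
have f1 n z : (f n z).[1] = 1.
  by rewrite /f /c !(hornerE, horner_exp) subrr mulr0 addr0 expr1n subrr mulr0 addr0.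
have f0 n z : f n z != 0.
  by apply: contra_eq_neq (f1 n z) => ->; rewrite horner0 eq_sym oner_eq0.
have polyopB1 p y' : polyop T (p - 1) y' = polyop T p y' - y'.
  by rewrite polyopD -scaleN1r polyopZ polyop1 scaleN1r.
have cc n : continuous (fun s => polyop T (c s ^+ n) x).
  elim: n => [|n IH] s.
    have -> : (fun s => polyop T (c s ^+ 0) x) = fun=> x.
      by apply/funext => t; rewrite expr0 polyop1.
    exact: cvg_cst.
  have -> : (fun s => polyop T (c s ^+ n.+1) x) = fun s => polyop T (c s ^+ n) x +
      (s%:C)%C *: polyop T ('X - 1) (polyop T (c s ^+ n) x).
    by apply/funext => t; rewrite exprS polyopM polyopD polyop1 polyopZ.
  apply: cvg_lmodD; first exact: IH.
  apply: cvg_lmodZ; first exact: real_complex_continuous.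
  by apply: continuous_comp; [exact: IH|exact: polyop_continuous].
have fE n z : polyop T (f n z) x = x + (z.2%:C)%C *: (polyop T (c z.1 ^+ n) x - x).
  by rewrite polyopD polyop1 polyopZ polyopB1.
have fc n : continuous (fun z => polyop T (f n z) x).
  rewrite (_ : (fun z => _) = fun z : R * R =>
    x + (z.2%:C)%C *: (polyop T (c z.1 ^+ n) x + (- x))); last exact/funext/fE.
  move=> z; apply: cvg_lmodD; first exact: cvg_cst.
  apply: cvg_lmodZ.
    apply: (@continuous_comp _ _ _ (fun z : R * R => z.2)); last first.
      exact: real_complex_continuous.
    exact: cvg_snd.
  apply: cvg_lmodD; last exact: cvg_cst.
  exact: (@continuous_comp _ _ _ (fun z : R * R => z.1) _ z (@cvg_fst _ _ _ _ _) (@cc n _)).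
have lift n := angle_lift (weight_continuous wc (f0 n) (fc n)).
have [g1 [g1c g1w g1b _]] := lift 1%N.
have wf n s : (w \o f n) (s, 1) - (w \o f n) (s, 0) = w (c s ^+ n) - w 1.
  by rewrite /comp /f/= rmorph0 rmorph1 scale0r scale1r addr0 [1 + (_ - 1)]addrC subrK.
(* at s = 0 the radius is the constant 1, so the lift starts at 0 *)
have start n g :
   (forall s, 0 <= s <= 1 ->
        cos (g s - ((w \o f n) (s, 1) - (w \o f n) (s, 0))) = 1) ->
   (forall s, 0 <= s <= 1 ->
        (forall r, 0 <= r <= 1 -> 0 < cos ((w \o f n) (s, r) - (w \o f n) (s, 0))) ->
        `|g s| < pi / 2) -> g 0 = 0.
  move=> gw gb; have z01 : 0 <= (0 : R) <= 1 by rewrite lexx ler01.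
  have c00 : c 0 = 1 by rewrite /c rmorph0 scale0r addr0.
  apply: cos_eq1_small.
    apply: ltW; apply: lt_trans (gb 0 z01 _) _; last by have := @pi_gt0 R; lra.
    by move=> r _; rewrite /comp /f/= c00 expr1n subrr !scaler0 subrr cos0 ltr01.
  by have := gw 0 z01; rewrite wf c00 expr1n subrr subr0.
have one01 : 0 <= (1 : R) <= 1 by rewrite lexx ler01.
have c1X : c 1 = 'X by rewrite /c rmorph1 scale1r addrC subrK.
(* the angle swept along the powers c s ^+ n is n times the angle g1 1 *)
have bound n : (forall r, 0 <= r <= 1 -> 0 < cos ((w \o f n) (1, r) - (w \o f n) (1, 0))) ->
    `|g1 1 *+ n| < pi / 2.
  have [g [gc gw gb _]] := lift n => hn.
  suff -> : g1 1 *+ n = g 1 by apply: gb.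
  have := @cos1_constant R (fun s => g s - g1 s *+ n).
  rewrite (start _ _ g1w g1b) (start _ _ gw gb) mul0rn subrr => H.
  apply/esym/eqP; rewrite -subr_eq0 -H//.
  - move=> s s01; apply: cvgB; first exact: gc.
    by apply: cvgMn; exact: g1c.
  - move=> s s01; have h1 := gw s s01; have h2 := g1w s s01; rewrite wf in h1.
    rewrite wf expr1 in h2.
    have h3 : cos (- ((g1 s - (w (c s) - w 1)) *+ n)) = 1 by rewrite cosN cos1Mn.
    have h4 : cos (- (w 1)) = 1 by rewrite cosN.
    have h5 : cos (w 1 *+ n) = 1 by rewrite cos1Mn.
    have := cos1D (cos1D (cos1D (cos1D h1 h3) h4) h5) (wX (c s) n (c0 s)).
    congr (cos _ = _); move: (w _) (w _) (w _) (g s) (g1 s) => A B C D E.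
    by rewrite !mulrnBl; ring.
have [U xU hU] := wc 1 1 (oner_neq0 _) ltr01; rewrite polyop1 subrr in xU hU.
have [V [V0 Vb VU]] := nbhs_balanced xU.
(* n can be large with T^n x close to x, whereas the multiples of g1 1 by such n
   stay bounded *)
have g10 : g1 1 = 0.
  apply/eqP/negPn/negP => g0.
  pose N := Num.bound (pi / 2 / `|g1 1|).
  have [n Nn /= Vn] := xr (nbhs_sub x V0) (Goo N).
  have := bound n _; rewrite ltNge => /(_ _)/negP; apply.
    move=> r /andP[r0 r1]; rewrite /comp; have -> : f n (1, 0) = 1.
      by rewrite /f/= rmorph0 scale0r addr0.
    apply: hU; rewrite fE/= c1X polyopXn; apply: VU; apply: Vb => //.
    by rewrite norm_real_complex lecR ger0_norm.
  rewrite normrMn -[`|g1 1| *+ n]mulr_natl -ler_pdivrMr ?normr_gt0//.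
  apply: ltW; apply: lt_le_trans (_ : N%:R <= _); last by rewrite ler_nat.
  rewrite /N; apply: le_lt_trans (archi_boundP _); rewrite ?ler_norm//.
  by rewrite divr_ge0// divr_ge0// pi_ge0.
have wT : cos (w 'X) = 1.
  have := g1w 1 one01; rewrite g10 wf expr1 c1X sub0r cosN => c2.
  by rewrite (cos1_transfer c2).
have X0 : 'X != 0 :> {poly R[i]} by rewrite polyX_eq0.
have wXn n : cos (w 'X^n) = 1 by rewrite (cos1_transfer (wX 'X n X0)) cos1Mn.
apply: phases_target_closed => O yO.
have [_ [[n _ <-] On]] := xd yO; exists (iter n T x) => //.
by rewrite -polyopXn; apply: w1; rewrite ?expf_neq0.
Qed.

End Phases.
End AdditiveCase.
(** * Polynomial phases *)

Section ReturnFilters.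
Variables (R : realType) (X : topologicalLmodType R[i]) (T : {linear X -> X}).
Hypothesis T_cont : continuous T.
Variable x : X.
Hypothesis xd : forall y : X, closure [set iter n T x | n in [set: nat]] y.

(** Filters of times along which the orbit of [x] clusters everywhere and which
    are idempotent for addition: [return_add] says that a typical sum of two
    successive typical times is typical. *)
Record return_filter (G : set_system nat) : Prop := ReturnFilter {
  return_proper : ProperFilter G;
  return_infty : forall N, \forall n \near G, (N <= n)%N;
  return_add : forall B, G B -> \forall i \near G, \forall j \near G, B (i + j)%N;
  return_reach : forall (y : X) U B, nbhs y U -> G B ->
    exists2 n, B n & U (iter n T x)
}.

(** The range of [T^N] is dense, so the orbit remains dense after its first [N]
    terms are dropped. *)
Lemma return_filter_infty : return_filter \oo.
Proof.
have sd : (closure (circled_orbit T x))° !=set0.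
  by apply: interior_closure_full => y; exact: dense_circled.
split.
- exact: _.
- by move=> N; exact: nbhs_infty_ge.
- move=> B [N _ NB]; near=> i; near=> j; apply: NB => /=.
  by rewrite (leq_trans _ (leq_addr _ _))//; near: i; exact: nbhs_infty_ge.
- move=> y U B /nbhs_interior yU [N _ NB].
  have XN : 'X^N != 0 :> {poly R[i]} by rewrite expf_neq0// polyX_eq0.
  have [_ [[z _ <-] zU]] := polyop_dense_range T_cont sd XN yU.
  have [_ [[n _ <-] nU]] := xd (polyop_continuous T_cont zU).
  exists (N + n)%N; first by apply: NB; exact: leq_addr.
  by move: nU; rewrite /= polyopXn -iterD.
Unshelve. all: by end_near. Qed.

Definition recurrent_phase (G : set_system nat) (v : nat -> R) := forall i e, 0 < e ->
  \forall l \near G, 1 - e < cos (v (l + i)%N - v i).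

(** The new filter is generated by [G] and the sets where [u n = v n - v 0] is
    small modulo [2 pi].  Recurrence of the increments of [v] makes [u] additive in
    the limit, by telescoping, so that [orbit_phase0] applies: the orbit meets
    every open set at times of [G] where [u] is small. *)
Lemma return_filter_adjoin G (v : nat -> R) : return_filter G ->
  recurrent_phase G (fun n => v n.+1 - v n) ->
  exists2 G', return_filter G' & recurrent_phase G' v.
Proof.
move=> [PG Goo Gop xr] vD; pose u n := v n - v 0%N.
have uD i e : 0 < e -> \forall j \near G, 1 - e < cos (u (i + j)%N - u i - u j).
  elim: i e => [|i IH] e e0.
    near=> j; rewrite add0n [u 0%N]subrr subr0 subrr cos0; lra.
  have e40 : 0 < e / 4 by rewrite divr_gt0.
  near=> j; have h1 : 1 - e / 4 < cos (u (i + j)%N - u i - u j).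
    by near: j; exact: (IH _ e40).
  have h2 : 1 - e / 4 < cos (v (j + i).+1 - v (j + i)%N - (v i.+1 - v i)).
    by near: j; exact: (vD _ _ e40).
  have := cos_near1D h1 h2; rewrite mulrC divfK//; congr (_ < cos _).
  by rewrite /u addSn [(j + i)%N]addnC; ring.
have ph := orbit_phase0 T_cont xd PG Goo Gop uD xr.
pose G' : set_system nat := [set B | exists A e, [/\ G A, 0 < e &
  forall n, A n -> 1 - e < cos (u n) -> B n]].
have GG' B : G B -> G' B by move=> GB; exists B, 1; split=> // n.
have FG' : Filter G'.
  split.
  - by apply: GG'; exact: filterT.
  - move=> B1 B2 [A1 [e1 [GA1 e10 h1]]] [A2 [e2 [GA2 e20 h2]]].
    exists (A1 `&` A2), (Num.min e1 e2); split; first exact: filterI.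
      by rewrite lt_min e10.
    have m1 : Num.min e1 e2 <= e1 by rewrite ge_min lexx.
    have m2 : Num.min e1 e2 <= e2 by rewrite ge_min lexx orbT.
    move=> n [a1 a2] hn; split; [apply: h1|apply: h2] => //.
      by apply: le_lt_trans hn; lra.
    by apply: le_lt_trans hn; lra.
  - by move=> B1 B2 B12 [A [e [GA e0 h]]]; exists A, e; split=> // n An /(h _ An)/B12.
have reach' (y : X) U B : nbhs y U -> G' B -> exists2 n, B n & U (iter n T x).
  move=> yU [A [e [GA e0 h]]]; have [n [An Un]] := ph y _ _ _ yU GA e0.
  by rewrite subr0 polyopXn in Un * => un; exists n => //; exact: h.
have nearu e : 0 < e -> \forall n \near G', 1 - e < cos (u n).
  by move=> e0; exists setT, e; split=> //; exact: filterT.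
exists G'.
  split=> //.
  - apply: Build_ProperFilter_ex => B G'B.
    by have [n Bn _] := reach' x setT B filterT G'B; exists n.
  - by move=> N; apply: GG'; exact: Goo.
  - move=> B [A [e [GA e0 h]]].
    have e40 : 0 < e / 4 by rewrite divr_gt0.
    have e160 : 0 < e / 16 by rewrite divr_gt0.
    near=> i.
    have ui : 1 - e / 16 < cos (u i) by near: i; exact: (nearu _ e160).
    have Ai : \forall j \near G, A (i + j)%N by near: i; exact: (GG' _ (Gop _ GA)).
    near=> j; apply: h; first by near: j; exact: (GG' _ Ai).
    have uj : 1 - e / 16 < cos (u j) by near: j; exact: (nearu _ e160).
    have uij : 1 - e / 4 < cos (u (i + j)%N - u i - u j).
      by near: j; have := GG' _ (uD i _ e40); exact.
    have h1 : 1 - e / 4 < cos (u i + u j).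
      by apply: le_lt_trans (cos_near1D ui uj); lra.
    have := cos_near1D uij h1; rewrite mulrC divfK//; congr (_ < cos _).
    ring.
move=> i; elim: i => [|i IH] e e0.
  by apply: filterS (nearu e e0) => l; rewrite addn0.
have e40 : 0 < e / 4 by rewrite divr_gt0.
near=> l; have h1 : 1 - e / 4 < cos (v (l + i)%N - v i) by near: l; exact: (IH _ e40).
have h2 : 1 - e / 4 < cos (v (l + i).+1 - v (l + i)%N - (v i.+1 - v i)).
  by near: l; exact: (GG' _ (vD i _ e40)).
have := cos_near1D h1 h2; rewrite mulrC divfK// addnS; congr (_ < cos _).
ring.
Unshelve. all: by end_near. Qed.

Lemma size_poly_diff (P : {poly R}) n : (size P <= n.+1)%N ->
  (size (P \Po ('X + 1%:P) - P)%R <= n)%N.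
Proof.
move=> sP; have s2 : size ('X + 1%:P : {poly R}) = 2 by rewrite size_XaddC.
have sPo := size_comp_poly2 P s2.
apply/leq_sizeP => j nj; rewrite coefB; have [jP|Pj] := ltnP j (size P).
  have jn : j = n by apply/eqP; rewrite eqn_leq nj andbT -ltnS (leq_trans jP).
  have Pn : size P = n.+1 by apply/eqP; rewrite eqn_leq sP -jn.
  have := lead_coef_comp P (q := 'X + 1%:P); rewrite s2 lead_coefXaddC expr1n mulr1.
  by rewrite /lead_coef sPo Pn jn /= => ->//; rewrite subrr.
by rewrite !nth_default ?subrr// sPo.
Qed.

Lemma return_filter_poly (P : {poly R}) : exists2 G, return_filter G &
  recurrent_phase G (fun n => P.[n%:R]).
Proof.
move: {2}(size P) (leqnn (size P)) => n; elim: n P => [|n IH] P sP.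
  exists \oo; first exact: return_filter_infty.
  move: sP; rewrite leqn0 size_poly_eq0 => /eqP -> i e e0; near=> l.
  rewrite !horner0 subrr cos0; lra.
have [G GP GD] := IH _ (size_poly_diff sP); have PG := return_proper GP.
apply: return_filter_adjoin GP _ => i e e0; apply: filterS (GD i e e0) => l.
by rewrite !hornerE !horner_comp !hornerE !natr1.
Unshelve. all: by end_near. Qed.

Lemma twisted_orbit_dense (P : {poly R}) y : closure (twisted_orbit P T x) y.
Proof.
move=> U yU; have [G [PG Goo _ xr] GP] := return_filter_poly P.
have [e e0 [V yV VU]] := nbhs_rotation yU.
have y'V : nbhs (expi (- P.[0]) *: y) [set v | V (expi P.[0] *: v)].
  apply: scale_continuousl; rewrite scalerA -expiD subrr expi0 scale1r//.
have [n [n1 /= nP] Vn] := xr _ _ _ y'V (filterI (Goo 1%N) (GP 0%N e e0)).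
exists (expi P.[n%:R] *: iter n T x); split; first by exists n.
have := VU (P.[n%:R] - P.[0]) _ _ Vn.
by rewrite scalerA -expiD subrK; apply; rewrite addn0 in nP.
Qed.

End ReturnFilters.

Theorem theorem1p1 (R : realType) (X : topologicalLmodType R[i])
    (T : {linear X -> X}) (T_cont : continuous T) (x : X) :
  (hypercyclic T x <->
     forall P : {poly R}, dense (twisted_orbit P T x)) /\
  (hypercyclic T x <->
     exists P : {poly R}, (closure (twisted_orbit P T x))° !=set0).
Proof.
have i_ii : hypercyclic T x -> forall P : {poly R}, dense (twisted_orbit P T x).
  by move=> /dense_closureP xd P; apply/dense_closureP => y; exact: twisted_orbit_dense.
have ii_iii : (forall P : {poly R}, dense (twisted_orbit P T x)) ->
    exists P : {poly R}, (closure (twisted_orbit P T x))° !=set0.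
  by move=> h; exists 0; apply: interior_closure_full; exact/dense_closureP.
have iii_i : (exists P : {poly R}, (closure (twisted_orbit P T x))° !=set0) ->
    hypercyclic T x.
  move=> [P [z zP]]; apply/dense_closureP; apply: dense_orbit_of_circled => //.
  apply: somewhere_dense_circled => //; exists z; apply: filterS zP.
  apply: closure_subset => _ [n _ <-]; by exists P.[n%:R], n.
by split; split; auto.
Qed.
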